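(* Let $w\in S_{\mathbb Z}$, and let $m\ge 0$ be an integer such that $\gamma^m(w)\in S_\infty$. Then $$\mathfrak S_{\gamma^m(w)}=\sum_{\substack{\alpha\in\mathcal C\\ d(\alpha)\le m}}\overleftarrow{\kappa^w_\alpha}\cdot\mathbf e_{\gamma^m(\alpha)}.$$ Equivalently, for every $\alpha\in\mathcal C$ satisfying $d(\alpha)\le m$, $\kappa^{\gamma^m(w)}_{\gamma^m(\alpha)}=\overleftarrow{\kappa^w_\alpha}$.
   Context: Ring. $\Lambda^-=\Lambda(\ldots,x_{-1},x_0)$ is the ring of symmetric functions over $\mathbb Q$ in the variables $x_i$, $i\le 0$, and $\mathcal R=\Lambda^-\otimes_{\mathbb Q}\mathbb Q[x_i\mid i\in\mathbb Z]$, identified via multiplication with a ring of bounded-degree formal power series in the variables $x_i$, $i\in\mathbb Z$. Indices. $\mathcal C$ is the set of finitely supported tuples $\alpha=(\alpha_i)_{i\in\mathbb Z}$ of nonnegative integers, with shift $\gamma(\alpha)_i=\alpha_{i-1}$. The admissibility threshold of $\alpha\in\mathcal C$ is $d(\alpha)=\max_{i:\alpha_i\ne 0}(\alpha_i-i)$, with $d(0)=0$. Ordinary SEMs. An index $a\in\mathcal C$ is admissible if it is supported on positive integers and $a_i\le i$ for all $i\ge 1$; then $\mathbf e_a=\prod_{i\ge 1}\mathbf e_{a_i}(x_1,\ldots,x_i)$ is the ordinary standard elementary monomial (SEM). For $m\ge 0$, $\gamma^m(\alpha)$ is admissible iff $m\ge d(\alpha)$. The ordinary SEMs form a $\mathbb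 Q$-basis of $\mathbb Q[x_1,x_2,\ldots]$ (Fomin–Gelfand–Postnikov). Back stable SEMs. For $\alpha\in\mathcal C$, $\overleftarrow{\mathbf e}_\alpha=\prod_{i\in\mathbb Z}\mathbf e_{\alpha_i}(\ldots,x_{i-1},x_i)\in\mathcal R$, where $\mathbf e_d(\ldots,x_{k-1},x_k)$ is the elementary symmetric function in the variables $x_i$, $i\le k$. These form a $\mathbb Q$-basis of $\mathcal R$. Permutations. $S_{\mathbb Z}$ is the group of permutations of $\mathbb Z$ moving only finitely many integers; $S_\infty\subset S_{\mathbb Z}$ is the subgroup of those fixing every $i\le 0$; $s_i=(i,i+1)$; $\ell$ is Coxeter length. The shift acts by $\gamma(w)(i)=w(i-1)+1$ on $S_{\mathbb Z}$ and $\gamma(x_i)=x_{i+1}$ on variables. Schubert polynomials and coefficients. For $u\in S_\infty$, $\mathfrak S_u$ is the usual Schubert polynomial: $\mathfrak S_{w_0}=x_1^{n-1}x_2^{n-2}\cdots x_{n-1}$ for the longest $w_0\in S_n$, and $\partial_i\mathfrak S_u=\mathfrak S_{us_i}$ whenever $\ell(us_i)<\ell(u)$, where $\partial_i f=(f-s_if)/(x_i-x_{i+1})$. For $w\in S_{\mathbb Z}$, $\overleftarrow{\mathfrak S}_w=\lim_{m\to\infty}\gamma^{-m}\big(\mathfrak S_{\gamma^m(w)}\big)\in\mathcal R$ (coefficientwise limit, over $m$ with $\gamma^m(w)\in S_\infty$). The coefficients are defined by $\mathfrak S_u=\sum_a\kappa^u_a\,\mathbf e_a$ (sum over admissible $a$)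 for $u\in S_\infty$, and $\overleftarrow{\mathfrak S}_w=\sum_{\alpha\in\mathcal C}\overleftarrow{\kappa^w_\alpha}\,\overleftarrow{\mathbf e}_\alpha$ for $w\in S_{\mathbb Z}$. *)

(* Defs.v *)
From HB Require Import structures.
From mathcomp Require Export all_boot all_order all_algebra.
From mathcomp Require Export finmap monalg.
From mathcomp Require Export boolp classical_sets functions cardinality fsbigop.

Set Implicit Arguments.
Unset Strict Implicit.
Unset Printing Implicit Defensive.

Import Order.TTheory GRing.Theory Num.Theory.

Local Open Scope classical_set_scope.
Local Open Scope ring_scope.

(** * Permutations of the integers *)

Definition in_SZ (w : int -> int) : Prop :=
  bijective w /\ finite_set [set i | w i != i].

Definition in_Sinf (w : int -> int) : Prop :=
  in_SZ w /\ forall i : int, i <= 0 -> w i = i.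

Definition shift_perm (w : int -> int) : int -> int := fun i => w (i - 1) + 1.

Definition simple_refl (i : int) : int -> int :=
  fun j => if j == i then i + 1 else if j == i + 1 then i else j.

Definition word_perm (s : seq int) : int -> int :=
  foldr (fun i v => simple_refl i \o v) id s.

(* Least number of simple reflections in a word for [w] (junk value 0 if [w] is
   not a product of simple reflections). *)
Definition coxeter_length (w : int -> int) : nat :=
  xget 0%N [set n | (exists s, w = word_perm s /\ size s = n) /\
                    (forall s, w = word_perm s -> (n <= size s)%N)].

Definition longest_perm (n : nat) : int -> int :=
  fun i => if (1 <= i) && (i <= n%:Z) then n.+1%:Z - i else i.

(** * Polynomials and divided differences *)

Notation zmon := {cmonom int}.

(* Q[x_i | i in Z]; it contains Q[x_1, x_2, ...]. *)
Notation zpoly := {malg rat[{cmonom int}]}.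

Definition Xvar (i : int) : zpoly := << ucm i >>.

(* The Q-algebra endomorphism x_i |-> x_(sigma i). *)
Definition relabel (sigma : int -> int) (f : zpoly) : zpoly :=
  mmap (fun c : rat => c%:MP)
       (fun mu : zmon => \prod_(i <- finsupp mu) Xvar (sigma i) ^+ mu i)
       f.

(* The quotient (f - s_i f) / (x_i - x_(i+1)), an exact division. *)
Definition divided_diff (i : int) (f : zpoly) : zpoly :=
  xget 0 [set g | (Xvar i - Xvar (i + 1)) * g = f - relabel (simple_refl i) f].

(** * Schubert polynomials *)

Inductive is_schubert : (int -> int) -> zpoly -> Prop :=
| schubert_longest (n : nat) :
    is_schubert (longest_perm n) (\prod_(1 <= i < n) Xvar i%:Z ^+ (n - i))
| schubert_step (u : int -> int) (i : int) (f : zpoly) :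
    1 <= i -> is_schubert u f ->
    (coxeter_length (u \o simple_refl i) < coxeter_length u)%N ->
    is_schubert (u \o simple_refl i) (divided_diff i f).

(* S_u does not depend on the chain of divided differences leading to u, so
   there is exactly one such f when u is in S_infinity. *)
Definition schubert (u : int -> int) : zpoly :=
  xget 0 [set f | is_schubert u f].

(** * Indices *)

Notation zindex := {fsfun int -> nat with 0%N}.

Definition shift_index (a : zindex) : zindex :=
  [fsfun i in [fset (j + 1)%R | j in finsupp a]%fset => a (i - 1) | 0%N].

Definition admissible (a : zindex) : Prop :=
  (forall i : int, i <= 0 -> a i = 0%N) /\
  (forall i : int, 1 <= i -> (a i)%:Z <= i).

(* [head 0 (finsupp a)] only provides an index of the support to start from. *)
Definition threshold (a : zindex) : int :=
  let i0 := head 0 (finsupp a) in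
  if finsupp a == fset0 then 0
  else \big[Num.max/(a i0)%:Z - i0]_(i <- finsupp a) ((a i)%:Z - i).

(** * Ordinary standard elementary monomials *)

(* e_d(x_1, ..., x_n) *)
Definition esym (n d : nat) : zpoly :=
  \sum_(A : {set 'I_n} | #|A| == d) \prod_(j in A) Xvar (j.+1)%:Z.

Definition sem (a : zindex) : zpoly :=
  \prod_(i <- finsupp a | 1 <= i) esym `|i|%N (a i).

(** * Formal power series in the x_i, i in Z, and back stable SEMs *)

(* A series is its family of coefficients; multiplication is [series_mul], not
   the pointwise product of functions. *)
Definition series : Type := zmon -> rat.

Definition series_one : series := fun mu => (mu == mone)%:R.

Definition series_mul (f g : series) : series := fun mu =>
  \sum_(p \in [set p : zmon * zmon | mmul p.1 p.2 = mu])
    f p.1 * g p.2.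

(* e_d(..., x_(k-1), x_k): the sum of the squarefree monomials of degree d in
   the x_i with i <= k. *)
Definition back_esym (k : int) (d : nat) : series := fun mu =>
  ((mdeg mu == d) && all (fun i => (i <= k) && (mu i == 1%N)) (finsupp mu))%:R.

Definition back_sem (a : zindex) : series :=
  \big[series_mul/series_one]_(i <- finsupp a) back_esym i (a i).

(* Coefficientwise limit: each coefficient of gamma^(-m) (S_(gamma^m w)) is
   eventually constant in m. *)
Definition back_schubert (w : int -> int) : series := fun mu =>
  xget 0 [set c | exists N : nat, forall m : nat, (N <= m)%N ->
    in_Sinf (iter m shift_perm w) ->
    (relabel (fun i => i - m%:Z) (schubert (iter m shift_perm w)))@_mu = c].

(** * Expansion coefficients *)

Definition sem_expansion (f : zpoly)
    (k : zindex -> rat) : Prop :=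
  [/\ finite_set [set a | k a != 0],
      forall a, ~ admissible a -> k a = 0
    & f = \sum_(a \in [set a | admissible a]) k a *: sem a].

Definition back_sem_expansion (f : series)
    (k : zindex -> rat) : Prop :=
  finite_set [set a | k a != 0] /\
  forall mu, f mu = \sum_(a \in [set: zindex])
                      k a * back_sem a mu.

(* SEMs and back stable SEMs being bases, the expansions are unique. *)
Definition kappa (u : int -> int) : zindex -> rat :=
  xget (fun=> 0) [set k | sem_expansion (schubert u) k].

Definition back_kappa (w : int -> int) : zindex -> rat :=
  xget (fun=> 0) [set k | back_sem_expansion (back_schubert w) k].

(* Main.v *)
(** The divided difference [D_i] kills [e_a] when [a_i = 0]; otherwise it
    replaces the factor [e_(a_i)(x_1..x_i)] by [e_(a_i - 1)(x_1..x_(i-1))]. When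
    [a_(i-1) = 0] the result is again a SEM, and otherwise the straightening
    rule for [e_p e_q] makes it a combination of SEMs. Hence every Schubert
    polynomial has a SEM expansion, homogeneous of degree its length. The same
    operators, applied from left to right to a linear relation, show that SEMs
    are independent, and that a polynomial killed by [D_i] for all [i < p] only
    involves SEMs with [a_i = 0] for [i < p].

    Setting [x_1 = 0] and shifting the variables down sends [e_a] to the SEM of
    the unshifted index or to 0, commutes with divided differences, and
    sends [S_(gamma u)] to [S_u], so that the coefficients are stable under
    the shift. For large [M] the polynomial of [gamma^M w] is symmetric in
    [x_1, ..., x_(M-c)], so the indices that occur are supported above [-c] up
    to shift and have bounded degree; their thresholds are thus bounded
    independently of [M]. The stable coefficients therefore form a finite family,
    which is the back stable expansion: the terms of a series in the
    variables [x_i], [i > -M], are those of the ordinary SEMs shifted by [M]. *)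

Require Import Defs.
From HB Require Import structures.
From mathcomp Require Import ring zify.

Set Implicit Arguments.
Unset Strict Implicit.
Unset Printing Implicit Defensive.

Import Order.TTheory GRing.Theory Num.Theory.
Local Open Scope classical_set_scope.
Local Open Scope ring_scope.

(** * Substitutions and divided differences *)

Definition monom_eval (v : int -> zpoly) (mu : zmon) : zpoly :=
  \prod_(i <- finsupp mu) v i ^+ mu i.

Lemma monom_evalEw v (d : {fset int}) (mu : zmon) : (finsupp mu `<=` d)%fset ->
  monom_eval v mu = \prod_(i <- d) v i ^+ mu i.
Proof.
move=> le; rewrite /monom_eval (big_fset_incl _ le) // => i _.
by rewrite memNfinsupp => /eqP ->; rewrite expr0.
Qed.

Lemma monom_eval_mmorphism v : mmorphism (monom_eval v).
Proof.
split=> [x y|]; last by rewrite /monom_eval mdom1 big_seq_fset0.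
rewrite (monom_evalEw v (fsubsetUl (finsupp x) (finsupp y))).
rewrite (monom_evalEw v (fsubsetUr (finsupp x) (finsupp y))).
rewrite /monom_eval mdomD -big_split /=.
by apply: eq_bigr => i _; rewrite cmM exprD.
Qed.

HB.instance Definition _ v :=
  isMultiplicative.Build zmon zpoly (monom_eval v) (monom_eval_mmorphism v).

(** Arbitrary images [v] are allowed because the specialization [x_1 = 0] is not a relabelling;
    [relabel] is convertible to the case [v = Xvar \o sigma]. *)
Definition subst (v : int -> zpoly) : zpoly -> zpoly :=
  mmap (@mkmalgU zmon rat mone) (monom_eval v).

HB.instance Definition _ v := GRing.RMorphism.copy (subst v)
  (mmap (@mkmalgU zmon rat mone) (monom_eval v)).

Lemma relabelE sigma f : relabel sigma f = subst (Xvar \o sigma) f.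
Proof. by []. Qed.

Lemma substC v c : subst v c%:MP = c%:MP.
Proof. exact: mmapC. Qed.

Lemma substZ v c f : subst v (c *: f) = c *: subst v f.
Proof. by rewrite -!mul_malgC rmorphM /= substC. Qed.

Lemma substU v (mu : zmon) : subst v << mu >> = monom_eval v mu.
Proof. by rewrite /subst mmapU /= mpolyC1E mul1r. Qed.

Lemma substX v i : subst v (Xvar i) = v i.
Proof. by rewrite substU /monom_eval mdomU big_seq_fset1 cmUU. Qed.

Lemma malgU1M (a b : zmon) : << mmul a b >> = << a >> * << b >> :> zpoly.
Proof. by rewrite malgM_def fgmulUU mulr1. Qed.

Lemma malgU1_prod (T : Type) (r : seq T) (P : pred T) (F : T -> zmon) :
  << \big[mmul/mone]_(x <- r | P x) F x >> = \prod_(x <- r | P x) << F x >>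
    :> zpoly.
Proof. exact: (big_morph (fun m : zmon => << m >> : zpoly) malgU1M). Qed.

Lemma cm_prod (T : Type) (r : seq T) (P : pred T) (F : T -> zmon) i :
  (\big[mmul/mone]_(x <- r | P x) F x) i = (\sum_(x <- r | P x) F x i)%N.
Proof.
exact: (big_morph (fun m : zmon => m i) (fun a b => cmM i a b) (cm1 i)).
Qed.

Lemma monom_eval_Xvar (mu : zmon) : monom_eval Xvar mu = << mu >>.
Proof.
have XvarX i n : Xvar i ^+ n = << \big[mmul/mone]_(j < n) ucm i >>.
  by rewrite malgU1_prod /= prodr_const card_ord.
rewrite /monom_eval.
under eq_bigr do rewrite XvarX.
rewrite -malgU1_prod; congr (<< _ >>); apply/eqP/cmP => j.
rewrite cm_prod.
under eq_bigr => i _ do rewrite cm_prod sum_nat_const card_ord cmU.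
case: (boolP (j \in finsupp mu)) => jmu.
  rewrite (big_fsetD1 j) //= eqxx muln1 big_seq big1 ?addn0 // => i.
  by rewrite in_fsetD1 => /andP [/negbTE -> _]; rewrite muln0.
rewrite big_seq big1; first by move: jmu; rewrite memNfinsupp => /eqP.
by move=> i imu; case: eqP => [eij|]; rewrite ?muln0 //; rewrite -eij imu in jmu.
Qed.

Lemma subst_Xvar f : subst Xvar f = f.
Proof.
rewrite /subst mmapE [RHS]monalgE; apply: eq_bigr => k _.
by rewrite monom_eval_Xvar [LHS]fgmulUU mulr1 mul1m.
Qed.

Lemma subst_comp v w f : subst v (subst w f) = subst (subst v \o w) f.
Proof.
rewrite [subst w f]mmapE rmorph_sum [RHS]mmapE; apply: eq_bigr => k _.
rewrite rmorphM /= substC; congr (_ * _).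
by rewrite /monom_eval rmorph_prod; apply: eq_bigr => i _; rewrite rmorphXn.
Qed.

Lemma eq_subst v w : v =1 w -> subst v =1 subst w.
Proof. by move=> /funext ->. Qed.

(** Substituting each variable for itself exhibits [f] as a sum of products of constants and powers
    of variables. *)
Lemma zpoly_ind (P : zpoly -> Prop) :
  (forall c, P c%:MP) -> (forall i, P (Xvar i)) ->
  (forall f g, P f -> P g -> P (f + g)) ->
  (forall f g, P f -> P g -> P (f * g)) -> forall f, P f.
Proof.
move=> PC PX PD PM f; rewrite -[f]subst_Xvar /subst mmapE.
apply: big_ind => [||k _]; [by rewrite -(malgC0E) | exact: PD |].
apply: (PM) => //; rewrite /monom_eval.
apply: big_ind => [||i _]; [by rewrite -mpolyC1E | exact: PM |].
by elim: (k i) => [|n IH]; rewrite ?expr0 -?mpolyC1E // exprS; apply: PM.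
Qed.

Lemma mcoeffUM (k mu : zmon) (g : zpoly) :
  (<< k >> * g)@_(mmul k mu) = g@_mu.
Proof.
rewrite mcoeffMl msuppU1 big_seq_fset1.
under eq_bigr => l _ do rewrite mcoeffUU mul1r.
have eqk l : (mmul k l == mmul k mu) = (l == mu).
  apply/eqP/eqP => [/eqP/cmP h|-> //]; apply/eqP/cmP => i.
  by have := h i; rewrite !cmM => /addnI.
under eq_bigr => l _ do rewrite eqk.
case: (msuppP g mu) => h.
  rewrite (big_fsetD1 mu) //= eqxx big_seq big1 ?addr0 // => l.
  by rewrite in_fsetD1 => /andP [/negbTE ->].
rewrite big_seq big1 // => l lg; case: eqP => // e.
by rewrite -e lg in h.
Qed.

Lemma mcoeffXM i (mu : zmon) (g : zpoly) :
  (Xvar i * g)@_(mmul (ucm i) mu) = g@_mu.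
Proof. exact: mcoeffUM. Qed.

Lemma mcoeffXM0 i (mu : zmon) (g : zpoly) : mu i = 0%N -> (Xvar i * g)@_mu = 0.
Proof.
move=> h; rewrite mcoeffMl msuppU1 big_seq_fset1 big1 // => l _.
case: eqP => // e; move: h; rewrite -e cmM cmUU; lia.
Qed.

(* If [X_i g = X_j g], the coefficient of [g] at [mu] equals the one at
   [x_i mu / x_j], and is zero when [x_j] does not divide [mu]. *)
Lemma Xvar_sub_mul_eq0 i j (g : zpoly) :
  i != j -> (Xvar i - Xvar j) * g = 0 -> g = 0.
Proof.
move=> ij; rewrite mulrBl => /subr0_eq eqX; apply/malgP => mu; rewrite mcoeff0.
have [n] := ubnP (mu j); elim: n mu => [|n IH] mu lt; first by move: lt; rewrite ltn0.
rewrite -(mcoeffXM i) eqX.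
case: (posnP (mu j)) => [h|h].
  by apply: mcoeffXM0; rewrite cmM cmU h (negbTE ij).
pose nu := divcm mu (ucm j).
have emu : mu = mmul (ucm j) nu.
  by apply/eqP/cmP => l; rewrite cmM divcmE cmU; case: eqP => [<-|_]; lia.
have -> : mmul (ucm i) mu = mmul (ucm j) (mmul (ucm i) nu).
  by rewrite emu !mulmA (mulmC (ucm i)).
rewrite mcoeffXM; apply: IH.
rewrite cmM cmU divcmE cmUU (negbTE ij); lia.
Qed.

Lemma Xvar_subI i j (f g : zpoly) : i != j ->
  (Xvar i - Xvar j) * f = (Xvar i - Xvar j) * g -> f = g.
Proof.
move=> ij /eqP; rewrite -subr_eq0 -mulrBr => /eqP /(Xvar_sub_mul_eq0 ij) /eqP.
by rewrite subr_eq0 => /eqP.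
Qed.

Lemma neq_succ (i : int) : i != i + 1. Proof. by lia. Qed.

Ltac case_ifs :=
  repeat match goal with
  | |- context [if ?b then _ else _] =>
    lazymatch b with
    | context [if _ then _ else _] => fail
    | _ => case: (boolP b) => ?
    end
  end.

Lemma simple_reflK i : involutive (simple_refl i).
Proof.
by move=> j; rewrite /simple_refl; case_ifs; lia.
Qed.

Definition refl i : zpoly -> zpoly := subst (Xvar \o simple_refl i).

HB.instance Definition _ i := GRing.RMorphism.copy (refl i)
  (subst (Xvar \o simple_refl i)).

Lemma reflX i j : refl i (Xvar j) = Xvar (simple_refl i j).
Proof. exact: substX. Qed.

Lemma reflZ i c f : refl i (c *: f) = c *: refl i f.
Proof. exact: substZ. Qed.

Lemma simple_refl1 i : simple_refl i i = i + 1.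
Proof. by rewrite /simple_refl eqxx. Qed.

Lemma simple_refl2 i : simple_refl i (i + 1) = i.
Proof. by rewrite /simple_refl eqxx eq_sym (negbTE (neq_succ i)). Qed.

Lemma simple_refl_id i j : j != i -> j != i + 1 -> simple_refl i j = j.
Proof. by rewrite /simple_refl => /negbTE -> /negbTE ->. Qed.

Lemma subst_refl v i f : subst v (refl i f) = subst (v \o simple_refl i) f.
Proof. by rewrite /refl subst_comp; apply: eq_subst => j /=; rewrite substX. Qed.

Lemma refl_subst v i f : refl i (subst v f) = subst (refl i \o v) f.
Proof. exact: subst_comp. Qed.

Lemma reflK i : involutive (refl i).
Proof.
move=> f; rewrite {1}/refl subst_refl -[RHS]subst_Xvar; apply: eq_subst => j /=.
by rewrite simple_reflK.
Qed.

Lemma twisted_additivity (R : comNzRingType) (x f g rf rg f' g' : R) :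
  x * f' = f - rf -> x * g' = g - rg -> x * (f' + g') = f + g - (rf + rg).
Proof. by move=> hf hg; rewrite mulrDr hf hg opprD addrACA. Qed.

(** With [x] in the role of [x_i - x_(i+1)], this is the rule [D (f g) = D f * g + s f * D g], in
    division-free form. *)
Lemma twisted_leibniz (R : comNzRingType) (x f g rf rg f' g' : R) :
  x * f' = f - rf -> x * g' = g - rg ->
  x * (f' * g + rf * g') = f * g - rf * rg.
Proof.
move=> hf hg; rewrite mulrDr mulrA hf mulrCA hg.
by rewrite mulrBr mulrBl addrA subrK.
Qed.

(** Divisibility is visible on constants and variables, and passes to sums and products by the
    twisted rules. *)
Lemma divided_diff_exists i f :
  exists g, (Xvar i - Xvar (i + 1)) * g = f - refl i f.
Proof.
elim/zpoly_ind: f => [c|j|f g [f' hf] [g' hg]|f g [f' hf] [g' hg]].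
- by exists 0; rewrite mulr0 /refl substC subrr.
- rewrite reflX /simple_refl; case: eqP => [->|_]; first by exists 1; rewrite mulr1.
  case: eqP => [->|_]; first by exists (-1); rewrite mulrN1 opprB.
  by exists 0; rewrite mulr0 subrr.
- exists (f' + g'); have e := rmorphD (refl i) f g.
  by have h := twisted_additivity hf hg; rewrite -e in h.
- exists (f' * g + refl i f * g'); have e := rmorphM (refl i) f g.
  by have h := twisted_leibniz hf hg; rewrite -e in h.
Qed.

(** Existence of the quotient excludes the default value of [xget]. *)
Lemma divided_diffP i f :
  (Xvar i - Xvar (i + 1)) * divided_diff i f = f - refl i f.
Proof.
rewrite /divided_diff; case: xgetP => [g _ //|h].
by have [g hg] := divided_diff_exists i f; case: (h g).
Qed.

Lemma twisted_linearity (R : comAlgType rat) (c : rat) (x f g rf rg f' g' : R) :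
  x * f' = f - rf -> x * g' = g - rg ->
  x * (c *: f' + g') = c *: f + g - (c *: rf + rg).
Proof.
by move=> hf hg; rewrite mulrDr -scalerAr hf hg scalerBr opprD addrACA.
Qed.

Lemma divided_diff_linear i : linear (divided_diff i).
Proof.
move=> c f g; apply: (Xvar_subI (neq_succ i)); rewrite divided_diffP.
have e := etrans (rmorphD (refl i) (c *: f) g) (congr1 (+%R^~ _) (reflZ i c f)).
rewrite e; apply/ssrfun.esym.
by apply: twisted_linearity; apply: divided_diffP.
Qed.

HB.instance Definition _ i := GRing.isLinear.Build rat zpoly zpoly *:%R
  (divided_diff i) (divided_diff_linear i).

HB.instance Definition _ v := GRing.isScalable.Build rat zpoly zpoly *:%R
  (subst v) (substZ v).

Lemma relabel_comp sigma tau f :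
  subst (Xvar \o sigma) (subst (Xvar \o tau) f) = subst (Xvar \o (sigma \o tau)) f.
Proof.
apply: etrans (subst_comp (Xvar \o sigma) (Xvar \o tau) f) _.
by apply: eq_subst => j; apply: substX.
Qed.

Lemma refl_refl i j f :
  refl i (refl j f) = subst (Xvar \o (simple_refl i \o simple_refl j)) f.
Proof. exact: relabel_comp. Qed.

Lemma refl_refl_refl i j k f : refl i (refl j (refl k f)) =
  subst (Xvar \o (simple_refl i \o (simple_refl j \o simple_refl k))) f.
Proof.
apply: etrans (congr1 (refl i) (refl_refl j k f)) _.
exact: (relabel_comp (simple_refl i)).
Qed.

Lemma refl_braid i f :
  refl i (refl (i + 1) (refl i f)) = refl (i + 1) (refl i (refl (i + 1) f)).
Proof.
apply: etrans (refl_refl_refl i (i + 1) i f) _.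
apply: etrans _ (ssrfun.esym (refl_refl_refl (i + 1) i (i + 1) f)).
apply: eq_subst => j /=; congr Xvar; rewrite /simple_refl; case_ifs; lia.
Qed.

Lemma refl_comm i j f : (i + 1 < j) || (j + 1 < i) ->
  refl i (refl j f) = refl j (refl i f).
Proof.
move=> ij; apply: etrans (refl_refl i j f) _.
apply: etrans _ (ssrfun.esym (refl_refl j i f)).
apply: eq_subst => k /=; congr Xvar; move: ij; rewrite /simple_refl; case_ifs; lia.
Qed.

(* The specialization [x_1 = 0] followed by the shift [x_i |-> x_(i-1)]. *)
Definition drop_var (i : int) : zpoly := if i <= 1 then 0 else Xvar (i - 1).

(** Both sides are substitutions, so they are compared on variables: for [1 <= i], [s_(i+1)]
    preserves the set of indices [j <= 1] that are sent to zero. *)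
Lemma subst_drop_refl i f : 1 <= i ->
  subst drop_var (refl (i + 1) f) = refl i (subst drop_var f).
Proof.
move=> i1; apply: etrans (subst_refl drop_var (i + 1) f) _.
apply: etrans _ (ssrfun.esym (refl_subst drop_var i f)).
apply: eq_subst => j /=; rewrite /drop_var (fun_if (refl i)) rmorph0 reflX.
have -> : (simple_refl (i + 1) j <= 1) = (j <= 1).
  by rewrite /simple_refl; case_ifs; lia.
case: (lerP j 1) => j1; [reflexivity | congr Xvar].
by rewrite /simple_refl; case_ifs; lia.
Qed.

(* Divided differences are studied in this abstract setting because unification
   of products in [zpoly] unfolds the monomials and is prohibitively slow. *)
Record dd_algebra := DDAlgebra {
  dd_sort : comAlgType rat;
  dd_X : int -> dd_sort;
  dd_refl : int -> {lrmorphism dd_sort -> dd_sort};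
  dd_diff : int -> {linear dd_sort -> dd_sort};
  dd_drop : {lrmorphism dd_sort -> dd_sort};
  dd_X_subI : forall i j f g, i != j ->
    (dd_X i - dd_X j) * f = (dd_X i - dd_X j) * g -> f = g;
  dd_reflX : forall i j, dd_refl i (dd_X j) = dd_X (simple_refl i j);
  dd_reflK : forall i, involutive (dd_refl i);
  dd_refl_braid : forall i f,
    dd_refl i (dd_refl (i + 1) (dd_refl i f)) =
    dd_refl (i + 1) (dd_refl i (dd_refl (i + 1) f));
  dd_refl_comm : forall i j f, (i + 1 < j) || (j + 1 < i) ->
    dd_refl i (dd_refl j f) = dd_refl j (dd_refl i f);
  dd_diffP : forall i f,
    (dd_X i - dd_X (i + 1)) * dd_diff i f = f - dd_refl i f;
  dd_drop1 : dd_drop (dd_X 1) = 0;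
  dd_dropX : forall i, 2 <= i -> dd_drop (dd_X i) = dd_X (i - 1);
  dd_drop_refl : forall i f, 1 <= i ->
    dd_drop (dd_refl (i + 1) f) = dd_refl i (dd_drop f) }.

Lemma drop_var1 : subst drop_var (Xvar 1) = 0.
Proof. by rewrite substX /drop_var lexx. Qed.

Lemma drop_varX i : 2 <= i -> subst drop_var (Xvar i) = Xvar (i - 1).
Proof. by move=> i2; rewrite substX /drop_var ifF //; lia. Qed.

Definition zpoly_dd : dd_algebra :=
  @DDAlgebra zpoly Xvar
    (fun i => subst (Xvar \o simple_refl i)) (fun i => divided_diff i)
    (subst drop_var) Xvar_subI reflX reflK refl_braid refl_comm divided_diffP
    drop_var1 drop_varX subst_drop_refl.

(** * Elementary symmetric polynomials and SEMs under divided differences *)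

Section Abstract.
Context (S : dd_algebra).
Local Notation A := (dd_sort S).
Local Notation X := (dd_X S).
Local Notation s := (dd_refl S).
Local Notation D := (dd_diff S).

Lemma dd_diff_uniq i (f g : A) :
  (X i - X (i + 1)) * g = f - s i f -> D i f = g.
Proof. by rewrite -dd_diffP => /ssrfun.esym/(dd_X_subI (neq_succ i)). Qed.

Lemma dd_diffM i (f g : A) : s i g = g -> D i (g * f) = g * D i f.
Proof.
move=> hg; apply: dd_diff_uniq.
by rewrite mulrCA dd_diffP rmorphM /= hg mulrBr.
Qed.

Lemma dd_diff_fixed i (f : A) : s i f = f -> D i f = 0.
Proof. by move=> hf; apply: dd_diff_uniq; rewrite hf mulr0 subrr. Qed.

Lemma dd_refl_diff i (f : A) : s i (D i f) = D i f.
Proof.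
apply: (dd_X_subI (neq_succ i)); rewrite dd_diffP.
have : s i ((X i - X (i + 1)) * D i f) = s i (f - s i f) by rewrite dd_diffP.
rewrite rmorphM !rmorphB /= !dd_reflX simple_refl1 simple_refl2 dd_reflK.
by move=> h; rewrite -[RHS]opprB -h -mulNr opprB.
Qed.

Lemma dd_diff_diff i (f : A) : D i (D i f) = 0.
Proof. exact/dd_diff_fixed/dd_refl_diff. Qed.

Lemma dd_diff_comm i j (f : A) : (i + 1 < j) || (j + 1 < i) ->
  D i (D j f) = D j (D i f).
Proof.
move=> ij; apply: dd_diff_uniq.
apply: (dd_X_subI (neq_succ j)).
rewrite mulrCA dd_diffP.
have Xj : s i (X j - X (j + 1)) = X j - X (j + 1).
  by rewrite rmorphB /= !dd_reflX !simple_refl_id //; lia.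
have Xi : s j (X i - X (i + 1)) = X i - X (i + 1).
  by rewrite rmorphB /= !dd_reflX !simple_refl_id //; lia.
have e1 : (X j - X (j + 1)) * s i (D j f) = s i (f - s j f).
  by rewrite -dd_diffP rmorphM /= Xj.
have e2 : (X i - X (i + 1)) * s j (D i f) = s j (f - s i f).
  by rewrite -dd_diffP rmorphM /= Xi.
by rewrite !mulrBr !dd_diffP e1 e2 !rmorphB /= (dd_refl_comm _ ij); ring.
Qed.

(** Here [x], [y], [z] are the three differences of variables, and the prefixes [s], [t] mark images
    under the two reflections; the conclusion is the alternating sum over the six permutations. *)
Lemma braid_identity (R : comNzRingType)
    (x y z a b c h th sth f sf tf tsf stf stsf : R) :
  z = x + y -> x * a = b - c -> y * b = h - th -> z * c = h - sth ->
  x * h = f - sf -> z * th = tf - tsf -> y * sth = stf - stsf ->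
  x * (z * (y * a)) = f - sf - tf + tsf + stf - stsf.
Proof.
move=> ez eA eB eC eh eth esth.
transitivity (z * (y * (x * a))); first by ring.
rewrite eA; transitivity (z * (y * b) - y * (z * c)); first by ring.
rewrite eB eC; transitivity ((z - y) * h - z * th + y * sth); first by ring.
have -> : z - y = x by rewrite ez; ring.
by rewrite eh eth esth; ring.
Qed.

(* Multiplied by the Vandermonde product, both sides become the alternating
   sum of [f] over the symmetric group on [x_i, x_(i+1), x_(i+2)]. *)
Lemma dd_diff_braid i (f : A) :
  D i (D (i + 1) (D i f)) = D (i + 1) (D i (D (i + 1) f)).
Proof.
have s1 : simple_refl i (i + 1 + 1) = i + 1 + 1 by apply: simple_refl_id; lia.
have s2 : simple_refl (i + 1) i = i by apply: simple_refl_id; lia.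
(* One computation serves both sides of the braid relation, with [j] and [k] equal to [i] and
   [i + 1] in either order. *)
have alt j k g (x y z : A) : x = X j - X (j + 1) -> y = X k - X (k + 1) ->
    s k x = z -> s j z = y -> s j y = z -> z = x + y ->
    x * (z * (y * D j (D k (D j g)))) =
    g - s j g - s k g + s k (s j g) + s j (s k g) - s j (s k (s j g)).
  move=> ex ey kx jz jy exyz; have dP := @dd_diffP S.
  set h := D j g; have hh : s j h = h by exact: dd_refl_diff.
  have eh := dP j g; rewrite -/h -ex in eh.
  have eth := congr1 (s k) eh; rewrite rmorphM rmorphB /= kx in eth.
  have esth := congr1 (s j) eth; rewrite rmorphM rmorphB /= jz in esth.
  have eB := dP k h; rewrite -ey in eB.
  have eC := congr1 (s j) eB; rewrite rmorphM rmorphB /= hh jy in eC.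
  have eA := dP j (D k h); rewrite -ex in eA.
  exact: braid_identity exyz eA eB eC eh eth esth.
(* The three factors of the Vandermonde product are introduced on both sides, each being
   cancellable. *)
apply: (dd_X_subI (neq_succ i)); apply: (@dd_X_subI S i (i + 1 + 1)); first by lia.
apply: (dd_X_subI (neq_succ (i + 1))).
set x := X i - X (i + 1); set z := X i - _; set y := X (i + 1) - _.
have exyz : z = x + y by rewrite /x addrA subrK.
have e1 : x * (z * (y * D i (D (i + 1) (D i f)))) =
    f - s i f - s (i + 1) f + s (i + 1) (s i f) + s i (s (i + 1) f)
      - s i (s (i + 1) (s i f)).
  apply: (alt i (i + 1) f x y z) => //.
  - by rewrite rmorphB /= !dd_reflX simple_refl1 s2.
  - by rewrite rmorphB /= !dd_reflX s1 simple_refl1.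
  - by rewrite rmorphB /= !dd_reflX s1 simple_refl2.
have e2 : y * (z * (x * D (i + 1) (D i (D (i + 1) f)))) =
    f - s (i + 1) f - s i f + s i (s (i + 1) f) + s (i + 1) (s i f)
      - s (i + 1) (s i (s (i + 1) f)).
  have exyz' : z = y + x by rewrite addrC.
  apply: (alt (i + 1) i f y x z) => //.
  - by rewrite rmorphB /= !dd_reflX s1 simple_refl2.
  - by rewrite rmorphB /= !dd_reflX s2 simple_refl2.
  - by rewrite rmorphB /= !dd_reflX s2 simple_refl1.
transitivity (x * (z * (y * D i (D (i + 1) (D i f))))); first by ring.
rewrite e1.
transitivity (y * (z * (x * D (i + 1) (D i (D (i + 1) f))))); last by ring.
by rewrite e2 dd_refl_braid; ring.
Qed.

Lemma dd_drop_diff i (f : A) : 1 <= i ->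
  dd_drop S (D (i + 1) f) = D i (dd_drop S f).
Proof.
move=> i1; apply/ssrfun.esym/dd_diff_uniq.
have -> : X i - X (i + 1) = dd_drop S (X (i + 1) - X (i + 1 + 1)).
  by rewrite rmorphB /= !dd_dropX ?addrK //; lia.
by rewrite -(rmorphM (dd_drop S)) dd_diffP rmorphB /= dd_drop_refl.
Qed.

Definition dd_esym (n d : nat) : A :=
  \sum_(B : {set 'I_n} | #|B| == d) \prod_(j in B) X (j.+1)%:Z.

(** The generating polynomial in the degree: recurrence, symmetry and specialization are read off
    its linear factors instead of sums over subsets. *)
Definition esym_gen (n : nat) : {poly A} :=
  \prod_(j < n) (1 + (X (j.+1)%:Z)%:P * 'X).

Lemma esym_genE n d : (esym_gen n)`_d = dd_esym n d.
Proof.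
rewrite /esym_gen.
under eq_bigr do rewrite addrC.
rewrite bigA_distr coef_sum /dd_esym [RHS]big_mkcond /=; apply: eq_bigr => B _.
rewrite -big_mkcond /= big_split /= -rmorph_prod prodr_const coefCM coefXn.
by rewrite eq_sym; case: eqP; rewrite ?mulr1 ?mulr0.
Qed.

Lemma esym_genS n : esym_gen n.+1 = esym_gen n * (1 + (X n.+1%:Z)%:P * 'X).
Proof. by rewrite /esym_gen big_ord_recr. Qed.

Lemma dd_esym0 n : dd_esym n 0 = 1.
Proof.
rewrite -esym_genE; elim: n => [|n IH]; first by rewrite /esym_gen big_ord0 coefC.
by rewrite esym_genS mulrDr mulr1 coefD IH mulrA coefMX addr0.
Qed.

Lemma dd_esymS n d :
  dd_esym n.+1 d.+1 = dd_esym n d.+1 + X n.+1%:Z * dd_esym n d.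
Proof.
rewrite -!esym_genE esym_genS mulrDr mulr1 coefD; congr (_ + _).
by rewrite mulrA coefMX mulrC coefCM.
Qed.

Lemma dd_esym_gt n d : (n < d)%N -> dd_esym n d = 0.
Proof.
elim: n d => [|n IH] [|d] //; last first.
  by move=> nd; rewrite dd_esymS !IH ?mulr0 ?addr0 //; lia.
by rewrite -esym_genE /esym_gen big_ord0 coefC.
Qed.

(** The reflection exchanges the factors of [x_k] and [x_(k+1)]: both are absent when [n < k], both
    present when [k < n]. *)
Lemma dd_refl_esym_gen (k n : nat) : (0 < k)%N -> n != k ->
  map_poly (s k%:Z) (esym_gen n) = esym_gen n.
Proof.
case: k => // k _.
have sL j : map_poly (s k.+1%:Z) (1 + (X j)%:P * 'X) =
    1 + (X (simple_refl k.+1%:Z j))%:P * 'X.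
  by rewrite rmorphD rmorph1 rmorphM /= map_polyC map_polyX /= dd_reflX.
have lt : forall m, (m <= k)%N -> map_poly (s k.+1%:Z) (esym_gen m) = esym_gen m.
  elim=> [_|m IH mk]; first by rewrite /esym_gen big_ord0 rmorph1.
  by rewrite esym_genS rmorphM /= IH ?sL ?simple_refl_id //; lia.
elim: n => [_|n IH nk]; first exact: lt.
have [lnk|ltnk] := leqP n.+1 k; first exact: lt.
have [enk|nnk] := eqVneq n k.+1; last first.
  by rewrite esym_genS rmorphM /= sL IH ?simple_refl_id //; lia.
rewrite enk !esym_genS !rmorphM /= lt // !sL -[RHS]mulrA [X in _ = _ * X]mulrC mulrA.
have e2 : k.+2%:Z = k.+1%:Z + 1 by lia.
by rewrite e2 simple_refl1 simple_refl2.
Qed.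

Lemma dd_refl_esym i n d : 1 <= i -> n%:Z != i -> s i (dd_esym n d) = dd_esym n d.
Proof.
case: i => // k k1 nk; rewrite -!esym_genE.
by rewrite -[in RHS](@dd_refl_esym_gen k n) ?coef_map //; lia.
Qed.

(** In the recurrence on the last variable only [x_(k+1)] is moved by the reflection, and its
    divided difference is 1. *)
Lemma dd_diff_esymS (k d : nat) : D k.+1%:Z (dd_esym k.+1 d.+1) = dd_esym k d.
Proof.
rewrite dd_esymS linearD /= dd_diff_fixed ?dd_refl_esym //; try lia.
rewrite add0r mulrC dd_diffM ?dd_refl_esym //; try lia.
rewrite (@dd_diff_uniq _ _ 1) ?mulr1 // dd_reflX simple_refl1 //.
Qed.

Lemma dd_drop_esym n d : dd_drop S (dd_esym n d) = dd_esym n.-1 d.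
Proof.
have dropP : map_poly (dd_drop S) (esym_gen n) = esym_gen n.-1.
  case: n => [|n]; first by rewrite /esym_gen big_ord0 rmorph1.
  rewrite /esym_gen rmorph_prod big_ord_recl rmorphD rmorph1 rmorphM /=.
  rewrite map_polyC /= dd_drop1 mul0r addr0 mul1r; apply: eq_bigr => j _.
  by rewrite rmorphD rmorph1 rmorphM /= map_polyC map_polyX /= dd_dropX.
by rewrite -!esym_genE -dropP coef_map.
Qed.

(** In the correction term the two contributions of [x_(k+1)] cancel. *)
Lemma esym_straighten k p q :
  dd_esym k p * dd_esym k q.+1 = dd_esym k p.+1 * dd_esym k q +
    (dd_esym k p * dd_esym k.+1 q.+1 - dd_esym k q * dd_esym k.+1 p.+1).
Proof. by rewrite !dd_esymS; ring. Qed.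

End Abstract.

(** * Indices and the span of SEMs *)

Implicit Types a b : zindex.

Definition set_index a (i : int) (v : nat) : zindex :=
  [fsfun a with i |-> v].

Lemma set_indexE a i v j : set_index a i v j = if j == i then v else a j.
Proof. exact: fsfun_withE. Qed.

Lemma zindexP a b : (forall i, a i = b i) -> a = b.
Proof. by move=> h; apply/fsfunP. Qed.

Definition index_deg a : nat := (\sum_(i <- finsupp a) a i)%N.

Lemma index_degEw a (d : {fset int}) : (finsupp a `<=` d)%fset ->
  index_deg a = (\sum_(i <- d) a i)%N.
Proof.
move=> le; rewrite /index_deg (big_fset_incl _ le) // => i _.
by rewrite memNfinsupp => /eqP.
Qed.

Lemma index_deg_set a i v : (index_deg (set_index a i v) + a i = index_deg a + v)%N.
Proof.
pose d := (i |` finsupp a)%fset.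
have la : (finsupp a `<=` d)%fset by apply: fsubsetUr.
have lb : (finsupp (set_index a i v) `<=` d)%fset.
  apply/fsubsetP => j; rewrite mem_finsupp set_indexE /d in_fsetU in_fset1.
  by case: (j =P i) => _ /=; rewrite ?mem_finsupp.
have id : i \in d by rewrite /d in_fsetU in_fset1 eqxx.
have ea := etrans (index_degEw la) (big_fsetD1 i id).
have eb := etrans (index_degEw lb) (big_fsetD1 i id).
have er : (\sum_(j <- (d `\ i)%fset) set_index a i v j =
           \sum_(j <- (d `\ i)%fset) a j)%N.
  rewrite big_seq [RHS]big_seq; apply: eq_bigr => j.
  by rewrite in_fsetD1 set_indexE => /andP [/negbTE ->].
by rewrite ea eb er set_indexE eqxx /=; lia.
Qed.

(** The index of [D i] applied to the SEM of [a] when [a (i - 1) = 0]: the factor at [i] loses one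
    degree and one variable. *)
Definition lower_index a (i : int) : zindex :=
  set_index (set_index a i 0) (i - 1) (a i).-1.

Lemma lower_indexE a i j : lower_index a i j =
  if j == i - 1 then (a i).-1 else if j == i then 0%N else a j.
Proof. by rewrite /lower_index !set_indexE. Qed.

Lemma index_deg_lower a i d : a (i - 1) = 0%N -> a i != 0%N ->
  index_deg a = d.+1 -> index_deg (lower_index a i) = d.
Proof.
move=> a0 ai ad; have := index_deg_set (set_index a i 0) (i - 1) (a i).-1.
have := index_deg_set a i 0; rewrite -/(lower_index a i) set_indexE a0.
case: eqP => _; lia.
Qed.

Lemma admissible_lower a i : 1 <= i -> admissible a ->
  admissible (lower_index a i).
Proof.
move=> i1 [a0 a1]; split=> j hj; rewrite lower_indexE.
  case: eqP => [e|_]; last by case: eqP => // _; apply: a0.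
  (* The entry moved to position 0 is [a 1 - 1], which admissibility makes zero. *)
  have ei : i = 1 by lia.
  by have := a1 i i1; move: (a i) => n; lia.
case: eqP => [->|_]; last by case: eqP => [_|_]; [lia | apply: a1].
by have := a1 i i1; move: (a i) => n; lia.
Qed.

(** Nothing is lost: position [i - 1] was empty, and the predecessor is injective on nonzero
    entries. *)
Lemma lower_index_inj a b i : a (i - 1) = 0%N -> b (i - 1) = 0%N ->
  a i != 0%N -> b i != 0%N -> lower_index a i = lower_index b i -> a = b.
Proof.
move=> a0 b0 ai bi e; apply: zindexP => j.
have := congr1 (fun f : zindex => f j) e.
have := congr1 (fun f : zindex => f (i - 1)) e.
rewrite /= !lower_indexE eqxx.
case: eqP => [->|_]; first by rewrite a0 b0.
by case: eqP => [->|//]; lia.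
Qed.

Section AbstractSEM.
Context (S : dd_algebra).
Local Notation A := (dd_sort S).
Local Notation s := (dd_refl S).
Local Notation D := (dd_diff S).
Local Notation e := (dd_esym S).

Definition dd_sem a : A :=
  \prod_(i <- finsupp a | 1 <= i) e `|i|%N (a i).

Lemma dd_semEw a (d : {fset int}) : (finsupp a `<=` d)%fset ->
  dd_sem a = \prod_(i <- d | 1 <= i) e `|i|%N (a i).
Proof.
move=> le; rewrite /dd_sem big_mkcond [RHS]big_mkcond (big_fset_incl _ le) //.
by move=> i _; rewrite memNfinsupp => /eqP ->; rewrite dd_esym0 if_same.
Qed.

Lemma dd_sem_split a i : 1 <= i ->
  dd_sem a = e `|i|%N (a i) * dd_sem (set_index a i 0).
Proof.
move=> i1; pose d := (i |` finsupp a)%fset.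
have la : (finsupp a `<=` d)%fset by apply: fsubsetUr.
have lb : (finsupp (set_index a i 0) `<=` d)%fset.
  apply/fsubsetP => j; rewrite mem_finsupp set_indexE /d in_fsetU in_fset1.
  by case: (j =P i) => _ /=; rewrite ?mem_finsupp.
have id : i \in d by rewrite /d in_fsetU in_fset1 eqxx.
rewrite (dd_semEw la) (dd_semEw lb) big_mkcond (big_fsetD1 i id) i1.
rewrite [in RHS]big_mkcond [in RHS](big_fsetD1 i id) i1 set_indexE eqxx dd_esym0.
rewrite /= mul1r; congr (_ * _).
rewrite big_seq [RHS]big_seq; apply: eq_bigr => j.
by rewrite in_fsetD1 set_indexE => /andP [/negbTE ->].
Qed.

Lemma dd_sem_eq0 a : (forall i, i <= 0 -> a i = 0%N) -> ~ admissible a ->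
  dd_sem a = 0.
Proof.
move=> a0 na; have [i [i1 ai]] : exists i : int, 1 <= i /\ i < (a i)%:Z.
  apply: contrapT => h; apply: na; split=> // i i1.
  by case: (lerP (a i)%:Z i) => // ai; case: h; exists i.
by rewrite (dd_sem_split a i1) dd_esym_gt ?mul0r //; lia.
Qed.

Lemma dd_refl_sem i a : 1 <= i -> a i = 0%N -> s i (dd_sem a) = dd_sem a.
Proof.
move=> i1 ai; rewrite /dd_sem rmorph_prod /=; apply: eq_bigr => j j1.
have [ij|ij] := eqVneq j i; first by rewrite ij ai dd_esym0 rmorph1.
by rewrite dd_refl_esym //; lia.
Qed.

Lemma dd_diff_sem0 i a : 1 <= i -> a i = 0%N -> D i (dd_sem a) = 0.
Proof. by move=> i1 ai; rewrite dd_diff_fixed ?dd_refl_sem. Qed.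

Lemma dd_diff_semS i a : 1 <= i -> a i != 0%N ->
  D i (dd_sem a) = e `|i|.-1 (a i).-1 * dd_sem (set_index a i 0).
Proof.
move=> i1 ai; rewrite (dd_sem_split a i1) mulrC dd_diffM; last first.
  by rewrite dd_refl_sem // set_indexE eqxx.
rewrite mulrC; congr (_ * _).
case: (a i) ai => // p _; case: i i1 => // -[//|k] _ /=.
exact: dd_diff_esymS.
Qed.

Lemma dd_diff_sem_lower i a : 1 <= i -> admissible a -> a (i - 1) = 0%N ->
  a i != 0%N -> D i (dd_sem a) = dd_sem (lower_index a i).
Proof.
move=> i1 [a0 a1] ai1 ai; rewrite dd_diff_semS //.
have [ei|i2] : i = 1 \/ 1 <= i - 1 by lia.
  have e1 : a 1 = 1%N by have := a1 i i1; move: ai; rewrite ei; move: (a 1) => n; lia.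
  rewrite ei e1 dd_esym0 mul1r /lower_index e1 /=; congr dd_sem.
  apply: zindexP => j; rewrite !set_indexE; case: (j =P 1 - 1) => [->|//].
  by rewrite a0.
rewrite [RHS](dd_sem_split _ i2) lower_indexE eqxx; congr (e _ _ * dd_sem _).
  by lia.
apply: zindexP => j; rewrite !set_indexE.
have [->|//] := eqVneq j (i - 1); rewrite ai1; by case: ifP.
Qed.

(** Lists of terms may repeat an index, so that sums are concatenations; terms are collected only in
    [sem_span_expands]. *)
Definition sem_span (d : nat) (f : A) := exists r : seq (rat * zindex),
  (forall p, p \in r -> admissible p.2 /\ index_deg p.2 = d) /\
  f = \sum_(p <- r) p.1 *: dd_sem p.2.

Lemma sem_span0 d : sem_span d 0.
Proof. by exists [::]; split=> //; rewrite big_nil. Qed.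

Lemma sem_spanD d f g : sem_span d f -> sem_span d g -> sem_span d (f + g).
Proof.
move=> [r [hr ->]] [r' [hr' ->]]; exists (r ++ r'); split; last by rewrite big_cat.
by move=> p; rewrite mem_cat => /orP [/hr|/hr'].
Qed.

Lemma sem_spanZ d c f : sem_span d f -> sem_span d (c *: f).
Proof.
move=> [r [hr ->]]; exists [seq (c * p.1, p.2) | p <- r]; split.
  by move=> p /mapP [q /hr hq ->].
by rewrite big_map scaler_sumr; apply: eq_bigr => p _; rewrite scalerA.
Qed.

Lemma sem_spanB d f g : sem_span d f -> sem_span d g -> sem_span d (f - g).
Proof. by move=> hf hg; rewrite -scaleN1r; apply/sem_spanD/sem_spanZ. Qed.

Lemma sem_span_sum d (T : eqType) (r : seq T) (F : T -> A) :
  (forall t, t \in r -> sem_span d (F t)) -> sem_span d (\sum_(t <- r) F t).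
Proof.
move=> h; rewrite big_seq; apply: big_ind => //; first exact: sem_span0.
by move=> f g; apply: sem_spanD.
Qed.

(** No upper bound on the entries has to be checked: an entry exceeding its position makes the SEM
    zero. *)
Lemma sem_span_sem d a : (forall i, i <= 0 -> a i = 0%N) -> index_deg a = d ->
  sem_span d (dd_sem a).
Proof.
move=> a0 ad; have [adm|/(dd_sem_eq0 a0) ->] := EM (admissible a).
  exists [:: (1, a)]; split; first by move=> p; rewrite inE => /eqP ->.
  by rewrite big_seq1 scale1r.
exact: sem_span0.
Qed.

(* By [esym_straighten] the product of two elementary polynomials in the same
   [k + 1] variables is rewritten with one factor in [k + 2] variables. *)
Lemma sem_span_straighten k b q : admissible b -> b k.+1%:Z = 0%N ->
  b k.+2%:Z = 0%N -> forall p,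
  sem_span (p + q + index_deg b) (e k.+1 p * e k.+1 q * dd_sem b).
Proof.
move=> [b0 _] bk bk1.
(* The free positions [k + 1] and [k + 2] of [b] receive [x] and [y], so such a product is again a
   SEM, possibly zero. *)
have E x y : sem_span (x + y + index_deg b) (e k.+1 x * e k.+2 y * dd_sem b).
  pose b1 := set_index b k.+2%:Z y; pose b2 := set_index b1 k.+1%:Z x.
  have -> : e k.+1 x * e k.+2 y * dd_sem b = dd_sem b2.
    rewrite (@dd_sem_split b2 k.+1%:Z) // (@dd_sem_split (set_index _ _ _) k.+2%:Z) //.
    rewrite !set_indexE eqxx /= mulrA; congr (e _ _ * e _ _ * dd_sem _).
      have -> : (k.+2 == k.+1 :> int) = false by lia.
      by rewrite eqxx.
    apply: zindexP => i; rewrite !set_indexE.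
    have [->|_] := eqVneq i k.+2%:Z; first by rewrite bk1.
    by have [->|_] := eqVneq i k.+1%:Z; first by rewrite bk.
  apply: sem_span_sem.
    by move=> i i0; rewrite !set_indexE ifF ?ifF ?b0 //; lia.
  have := index_deg_set b1 k.+1%:Z x; have := index_deg_set b k.+2%:Z y.
  rewrite -/b1 -/b2 set_indexE bk bk1 ifF; lia.
elim: q => [|q IH] p.
  by have := E p 0%N; rewrite !dd_esym0.
rewrite esym_straighten mulrDl mulrBl; apply: sem_spanD; first by rewrite -addSnnS.
apply: sem_spanB; first exact: E.
by have := E q p.+1; rewrite (addnC q) addSnnS.
Qed.

(** When [a (i - 1)] is nonzero, two factors in [i - 1] variables appear; straightening uses
    position [i], which the divided difference has just emptied. *)
Lemma sem_span_diff d i f : 1 <= i -> sem_span d.+1 f -> sem_span d (D i f).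
Proof.
move=> i1 [r [hr ->]]; rewrite linear_sum; apply: sem_span_sum => -[c a] /hr /= {hr}.
move=> [adm ad]; rewrite linearZ; apply: sem_spanZ.
have [ai|ai] := eqVneq (a i) 0%N; first by rewrite dd_diff_sem0 //; apply: sem_span0.
have [ai1|ai1] := eqVneq (a (i - 1)) 0%N.
  rewrite dd_diff_sem_lower //; have [] := admissible_lower i1 adm => l0 _.
  by apply: sem_span_sem => //; apply: index_deg_lower.
have i2 : 2 <= i.
  have [//|lt] := lerP 2 i; have ei : i - 1 = 0 by lia.
  by case: adm => a0 _; move: ai1; rewrite ei a0.
rewrite dd_diff_semS // (@dd_sem_split _ (i - 1)); last by lia.
rewrite mulrA set_indexE ifF; last by lia.
case: i i1 i2 ai ai1 => // -[|[|k]] // _ _ ai ai1.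
have ek : (k.+2%:Z - 1 = k.+1%:Z)%R by lia.
rewrite ek in ai1 *; rewrite [in X in sem_span _ X]/=.
set b := set_index _ _ _.
have <- : ((a k.+2%:Z).-1 + a k.+1%:Z + index_deg b)%N = d.
  have := index_deg_set a k.+2%:Z 0.
  have := index_deg_set (set_index a k.+2%:Z 0) k.+1%:Z 0.
  rewrite -/b set_indexE ifF; lia.
case: adm => a0 a1; apply: sem_span_straighten.
- split=> j hj; rewrite !set_indexE; first by rewrite a0 // !if_same.
  by case: ifP => _; [lia | case: ifP => _; [lia | exact: a1]].
- by rewrite !set_indexE eqxx.
- by rewrite !set_indexE eqxx; case: eqP.
Qed.

End AbstractSEM.

(** * Linear independence of SEMs and uniqueness of expansions *)

Lemma uniq_map_filter (T T' : eqType) (P : pred T) (h : T -> T') (r : seq T) :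
  uniq (map h r) -> uniq (map h (filter P r)).
Proof. by apply: subseq_uniq; apply: map_subseq; apply: filter_subseq. Qed.

Lemma index_bound a : exists K : nat, forall i, a i != 0%N -> i <= K%:Z.
Proof.
exists (\sum_(i <- finsupp a) `|i|)%N => i ia.
have := mem_finsupp a i; rewrite ia => ia'; rewrite (big_fsetD1 i ia') /=; lia.
Qed.

(** Independence is proved by raising [j] from 0 to [k]; at [j = k] the support lies above [k - 1],
    so that [k] can be decreased, from [K] down to 0. *)
Definition tail_index (K k j : nat) a : Prop :=
  admissible a /\
  forall i, a i != 0%N -> i <= K%:Z /\ (i = j%:Z \/ k%:Z < i).

Section Independence.
Context (S : dd_algebra).
Local Notation A := (dd_sort S).
Local Notation D := (dd_diff S).
Local Notation sem := (dd_sem S).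

(** Indexing the relation by an auxiliary type lets the same coefficients be reused after the
    indices are lowered or shifted. *)
Definition sem_indep (Q : zindex -> Prop) : Prop :=
  forall (T : eqType) (r : seq T) (h : T -> zindex) (c : T -> rat),
    uniq (map h r) -> (forall t, t \in r -> Q (h t)) ->
    \sum_(t <- r) c t *: sem (h t) = 0 -> forall t, t \in r -> c t = 0.

Lemma dd_diff_sum (T : eqType) (r : seq T) (h : T -> zindex) (c : T -> rat) i :
  1 <= i -> (forall t, t \in r -> admissible (h t) /\ h t (i - 1) = 0%N) ->
  D i (\sum_(t <- r) c t *: sem (h t)) =
  \sum_(t <- [seq t <- r | h t i != 0%N]) c t *: sem (lower_index (h t) i).
Proof.
move=> i1 hr; rewrite linear_sum big_filter [RHS]big_mkcond [LHS]big_seq [RHS]big_seq.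
apply: eq_bigr => t /hr [adm h0]; rewrite linearZ /=.
case: eqP => [hi|/eqP hi]; last by rewrite dd_diff_sem_lower.
by rewrite dd_diff_sem0 ?scaler0.
Qed.

Lemma uniq_map_lower (T : eqType) (r : seq T) (h : T -> zindex) i :
  uniq (map h r) -> (forall t, t \in r -> h t (i - 1) = 0%N) ->
  uniq [seq lower_index (h t) i | t <- [seq t <- r | h t i != 0%N]].
Proof.
move=> ur hr; rewrite (map_comp (lower_index^~ i) h) map_inj_in_uniq.
  exact: uniq_map_filter.
move=> _ _ /mapP [t tr ->] /mapP [t' tr' ->].
move: tr tr'; rewrite !mem_filter => /andP [ti /hr t0] /andP [ti' /hr t0'].
exact: lower_index_inj.
Qed.

(* [D j.+1] maps the SEMs with [a j.+1 != 0] injectively to SEMs supported at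
   [j] and above [k], and kills the others. *)
Lemma sem_indep_step K k j : (j < k)%N ->
  sem_indep (tail_index K k j) -> sem_indep (tail_index K k j.+1).
Proof.
move=> jk IH T r h c ur hr sum0.
have ej : j.+1%:Z - 1 = j%:Z by lia.
have h0 t : t \in r -> h t (j.+1%:Z - 1) = 0%N.
  move=> /hr [_ ht]; apply/eqP; apply: contraT => /ht; rewrite ej; lia.
pose r' := [seq t <- r | h t j.+1%:Z != 0%N].
have c0 t : t \in r -> h t j.+1%:Z != 0%N -> c t = 0.
  move=> tr ht; have tr' : t \in r' by rewrite mem_filter ht.
  apply: (IH _ r' (fun t => lower_index (h t) j.+1%:Z) c) tr'.
  - exact: uniq_map_lower.
  - move=> u; rewrite mem_filter => /andP [hu ur'].
    have [adm tl] := hr u ur'; split; first exact: admissible_lower.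
    move=> i; rewrite lower_indexE ej; case: (i =P j%:Z) => [-> _|_].
      by have := tl _ hu; lia.
    by case: (i =P j.+1%:Z) => // ij /tl; lia.
  - rewrite -dd_diff_sum ?sum0 ?linear0 // => u ur'; split; last exact: h0.
    by have [] := hr u ur'.
move=> t tr; have [ht|] := eqVneq (h t j.+1%:Z) 0%N; last exact: c0.
(* The surviving terms have [a j.+1 = 0], so their support lies above [k] and the case of [j]
   applies again. *)
pose r2 := [seq t <- r | h t j.+1%:Z == 0%N].
have tr2 : t \in r2 by rewrite mem_filter ht eqxx.
apply: (IH _ r2 h c) tr2; first exact: uniq_map_filter.
  move=> u; rewrite mem_filter => /andP [/eqP hu /hr [adm tl]]; split=> // i hi.
  have := tl i hi; case=> iK [ei|]; last by split=> //; right.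
  by rewrite ei hu in hi.
apply: etrans sum0; rewrite big_filter [LHS]big_mkcond [LHS]big_seq [RHS]big_seq.
by apply: eq_bigr => u ur'; case: eqP => // /eqP /(c0 u ur') ->; rewrite scale0r.
Qed.

(** Only the zero index qualifies, position 0 being excluded by admissibility, and its SEM is 1. *)
Lemma sem_indep_tail0 K : sem_indep (tail_index K K 0).
Proof.
move=> T r h c ur hr sum0 t tr.
have h0 u : u \in r -> h u = h t.
  have z v : v \in r -> forall i, h v i = 0%N.
    move=> /hr [[a0 _] tl] i; apply/eqP; apply: contraT => hi.
    by have := tl i hi; case: (lerP i 0) => [/a0 e0|]; [rewrite e0 in hi | lia].
  by move=> ur'; apply: zindexP => i; rewrite !z.
have er : r = [:: t].
  case: r ur hr sum0 tr h0 => [//|u [|v r]] /=.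
    by move=> _ _ _; rewrite inE => /eqP ->.
  move=> /andP [nu _] _ _ tr h0; case/negP: nu.
  by rewrite inE (h0 u) ?(h0 v) ?eqxx // !inE eqxx ?orbT.
have sem1 : sem (h t) = 1.
  rewrite /dd_sem big1 // => i _; rewrite -[h t i]/((h t) i).
  have -> : h t i = 0%N; last exact: dd_esym0.
  have [[a0 _] tl] := hr t tr; apply/eqP; apply: contraT => hi.
  by have := tl i hi; case: (lerP i 0) => [/a0 e0|]; [rewrite e0 in hi | lia].
by move: sum0; rewrite er big_seq1 sem1 => /eqP; rewrite scaler_eq0 oner_eq0 orbF => /eqP.
Qed.

Lemma sem_indep_admissible : sem_indep admissible.
Proof.
move=> T r h c ur hr sum0.
have [K hK] : exists K : nat, forall t, t \in r -> forall i, h t i != 0%N -> i <= K%:Z.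
  elim: r {ur hr sum0} => [|t r [K IH]]; first by exists 0%N.
  have [K' hK'] := index_bound (h t); exists (maxn K K') => u.
  rewrite inE => /orP [/eqP ->|ur] i hi.
    by have := hK' i hi; lia.
  by have := IH u ur i hi; lia.
have main n : (n <= K)%N -> forall j, (j <= K - n)%N ->
    sem_indep (tail_index K (K - n) j).
  elim: n => [_|n IH nK].
    elim=> [_|j IHj jk]; first by rewrite subn0; apply: sem_indep_tail0.
    by rewrite subn0 in jk IHj *; apply: sem_indep_step => //; apply: IHj; lia.
  elim=> [_|j IHj jk]; last by apply: sem_indep_step => //; apply: IHj; lia.
  (* Support above [K - n.+1] is the same as support at its successor or above it, the last case for
     the previous [n]. *)
  have eKn : (K - n = (K - n.+1).+1)%N by lia.
  have := IH (ltnW nK) (K - n.+1).+1; rewrite eKn => /(_ (leqnn _)) ind.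
  move=> T' r' h' c' ur' hr' sum0'; apply: (ind T' r' h' c' ur' _ sum0') => t tr.
  have [adm tl] := hr' t tr; split=> // i hi; have [iK i0] := tl i hi; split=> //.
  case: i0 => [i0|]; last by lia.
  by case: adm => a0 _; rewrite i0 a0 in hi.
have := main K (leqnn K) 0%N; rewrite subnn => /(_ isT) ind.
apply: (ind T r h c ur _ sum0) => t tr; split; first exact: hr.
move=> i hi; split; first exact: hK hi.
by right; case: (hr t tr) => a0 _; case: (ltrP 0 i) => // /a0 i0; rewrite i0 in hi.
Qed.

Definition sem_expands (k : zindex -> rat) (f : A) : Prop :=
  exists r : seq zindex, [/\ uniq r, forall a, k a != 0 -> a \in r,
    forall a, a \in r -> admissible a & f = \sum_(a <- r) k a *: sem a].

(** Coefficients of repeated indices are added up; an index that does not occur gets an empty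
    sum. *)
Lemma sem_span_expands d f : sem_span d f ->
  exists2 k, sem_expands k f & forall a, k a != 0 -> index_deg a = d.
Proof.
move=> [r [hr ->]]; pose k a := \sum_(p <- r | p.2 == a) p.1.
have kP a : k a != 0 -> a \in map snd r.
  apply: contraR => ar; rewrite /k big_seq_cond big1 // => p /andP [pr /eqP pa].
  by rewrite -pa map_f in ar.
exists k; last by move=> a /kP /mapP [p /hr [_ pd] ->].
exists (undup (map snd r)); split.
- exact: undup_uniq.
- by move=> a /kP; rewrite mem_undup.
- by move=> a; rewrite mem_undup => /mapP [p /hr [pa _] ->].
under [RHS]eq_bigr => a _ do rewrite /k scaler_suml.
rewrite (exchange_big_dep xpredT) //= big_seq [RHS]big_seq.
apply: eq_bigr => p pr; rewrite -big_filter.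
have -> : [seq a <- undup (map snd r) | p.2 == a] = [:: p.2].
  rewrite (@eq_filter _ _ (pred1 p.2)); last by move=> a; rewrite /= eq_sym.
  by rewrite filter_pred1_uniq ?undup_uniq // mem_undup map_f.
by rewrite big_seq1.
Qed.

Lemma sem_expands_sub k f (r : seq zindex) : uniq r ->
  (forall a, k a != 0 -> a \in r) -> sem_expands k f ->
  f = \sum_(a <- r) k a *: sem a.
Proof.
move=> ur hr [r' [ur' hr' _ ->]].
pose P a := k a != 0.
have red (q : seq zindex) :
    \sum_(a <- q) k a *: sem a = \sum_(a <- filter P q) k a *: sem a.
  rewrite big_filter [RHS]big_mkcond; apply: eq_bigr => a _.
  by rewrite /P; case: eqP => // ->; rewrite scale0r.
rewrite red [RHS]red; apply: perm_big; apply: uniq_perm; rewrite ?filter_uniq //.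
move=> a; rewrite !mem_filter; case: (boolP (P a)) => //= ka.
by rewrite hr ?hr'.
Qed.

Lemma sem_expands_uniq k k' f : sem_expands k f -> sem_expands k' f -> k = k'.
Proof.
move=> hk hk'; have [r [ur hr ar _]] := hk; have [r' [ur' hr' ar' _]] := hk'.
pose q := undup (r ++ r').
have uq : uniq q by apply: undup_uniq.
have kq a : k a != 0 -> a \in q by rewrite mem_undup mem_cat => /hr ->.
have kq' a : k' a != 0 -> a \in q by rewrite mem_undup mem_cat => /hr' ->; rewrite orbT.
have ek := sem_expands_sub uq kq hk; have ek' := sem_expands_sub uq kq' hk'.
have dif : \sum_(a <- q) (k a - k' a) *: sem a = 0.
  under eq_bigr do rewrite scalerBl.
  by rewrite sumrB -ek -ek' subrr.
have z a : a \in q -> k a - k' a = 0.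
  apply: (@sem_indep_admissible _ q id (fun a => k a - k' a)) => //.
    by rewrite map_id.
  by move=> b; rewrite mem_undup mem_cat => /orP [/ar|/ar'].
apply/funext => a; have [/z /eqP|aq] := boolP (a \in q).
  by rewrite subr_eq0 => /eqP.
have [-> //|/kq h] := eqVneq (k a) 0; last by rewrite h in aq.
by have [-> //|/kq' h] := eqVneq (k' a) 0; rewrite h in aq.
Qed.

Lemma sem_expandsB k k' f f' : sem_expands k f -> sem_expands k' f' ->
  sem_expands (fun a => k a - k' a) (f - f').
Proof.
move=> hk hk'; have [r [ur hr ar _]] := hk; have [r' [ur' hr' ar' _]] := hk'.
pose q := undup (r ++ r').
have uq : uniq q by apply: undup_uniq.
have kq a : k a != 0 -> a \in q by rewrite mem_undup mem_cat => /hr ->.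
have kq' a : k' a != 0 -> a \in q by rewrite mem_undup mem_cat => /hr' ->; rewrite orbT.
exists q; split=> //.
- move=> a; have [e0|/kq //] := eqVneq (k a) 0.
  by rewrite e0 sub0r oppr_eq0 => /kq'.
- by move=> a; rewrite mem_undup mem_cat => /orP [/ar|/ar'].
- rewrite (sem_expands_sub uq kq hk) (sem_expands_sub uq kq' hk') -sumrB.
  by apply: eq_bigr => a _; rewrite scalerBl.
Qed.

(* Once [a j = 0] for all [j < i], the operator [D i] maps the SEMs with
   [a i != 0] injectively to SEMs. *)
Lemma sem_expands_killed k f (p : nat) : sem_expands k f ->
  (forall i : int, 1 <= i -> i < p%:Z -> D i f = 0) ->
  forall a, k a != 0 -> forall i, i < p%:Z -> a i = 0%N.
Proof.
move=> [r [ur hr ar ef]] Df.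
elim: p Df => [|p IH] Df a ka i ip.
  by have [a0 _] := ar a (hr a ka); apply: a0; lia.
have Df' j : 1 <= j -> j < p%:Z -> D j f = 0 by move=> j1 jp; apply: Df => //; lia.
have [{}ip|pi] := ltrP i p%:Z; first exact: (IH Df').
have ei : i = p%:Z by lia.
have [i1|i0] := lerP 1 i; last first.
  by have [a0 _] := ar a (hr a ka); apply: a0; lia.
apply/eqP; apply: contraT => ai.
pose r1 := [seq b <- r | k b != 0].
have sub1 b : b \in r1 -> admissible b /\ b (i - 1) = 0%N.
  rewrite mem_filter => /andP [kb br]; split; first exact: ar.
  by apply: (IH Df') => //; lia.
have ef1 : f = \sum_(b <- r1) k b *: sem b.
  rewrite ef big_filter [RHS]big_mkcond; apply: eq_bigr => b _.
  by case: eqP => // ->; rewrite scale0r.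
have := dd_diff_sum k i1 sub1; rewrite -ef1 Df //.
move=> /ssrfun.esym sum0.
have ar1 : a \in [seq b : zindex <- r1 | b i != 0%N] by rewrite !mem_filter ai ka hr.
suff k0 : k a = 0 by rewrite k0 eqxx in ka.
apply: (@sem_indep_admissible _ _ (fun b => lower_index b i) k _ _ sum0) ar1.
- apply: (uniq_map_lower (h := id)); first by rewrite map_id filter_uniq.
  by move=> b /sub1 [].
- by move=> b; rewrite mem_filter => /andP [_ /sub1 [adm _]]; apply: admissible_lower.
Qed.

End Independence.

(** * Shifts of indices and staircases *)

Lemma shift_indexE a i : shift_index a i = a (i - 1).
Proof.
rewrite /shift_index fsfunE; case: ifP => // /negP h.
apply/ssrfun.esym/eqP; apply: contraT => ai; case: h.
apply/imfsetP; exists (i - 1); last by rewrite subrK.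
by rewrite /= mem_finsupp.
Qed.

Definition unshift_index a : zindex :=
  [fsfun i in [fset (j - 1)%R | j in finsupp a]%fset => a (i + 1) | 0%N].

Lemma unshift_indexE a i : unshift_index a i = a (i + 1).
Proof.
rewrite /unshift_index fsfunE; case: ifP => // /negP h.
apply/ssrfun.esym/eqP; apply: contraT => ai; case: h.
apply/imfsetP; exists (i + 1); last by rewrite addrK.
by rewrite /= mem_finsupp.
Qed.

Lemma shift_indexK : cancel shift_index unshift_index.
Proof. by move=> a; apply: zindexP => i; rewrite unshift_indexE shift_indexE addrK. Qed.

Lemma unshift_indexK : cancel unshift_index shift_index.
Proof. by move=> a; apply: zindexP => i; rewrite shift_indexE unshift_indexE subrK. Qed.

(* The indices met along the descending chain from the longest permutation of
   size [n + 1] to that of size [n]. *)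
Definition stair (n k : nat) : zindex :=
  [fsfun i in [fset x | x in [seq j%:Z | j <- iota 1 n]]%fset =>
    if i == k%:Z then 0%N else `|i|%N | 0%N].

Lemma stairE n k i : stair n k i =
  if (1 <= i) && (i <= n%:Z) && (i != k%:Z) then `|i|%N else 0%N.
Proof.
rewrite /stair fsfunE; set b := (_ \in _).
have -> : b = (1 <= i) && (i <= n%:Z).
  apply/imfsetP/idP => [[x /mapP [j]]|/andP [i1 i2]].
    by rewrite mem_iota => hj -> ->; lia.
  exists i => //; apply/mapP; exists `|i|%N; last by lia.
  by rewrite mem_iota; lia.
by case: (_ && _) => //=; case: eqP.
Qed.

Lemma admissible_stair n k : admissible (stair n k).
Proof. by split=> i hi; rewrite stairE; case: ifP; lia. Qed.

(** Lowering at [k + 1] fills the gap at [k] with the entry [k] and leaves the gap at [k + 1]. *)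
Lemma lower_stair n k : (k < n)%N ->
  lower_index (stair n k) k.+1%:Z = stair n k.+1.
Proof.
move=> kn; apply: zindexP => i; rewrite lower_indexE !stairE.
have -> : k.+1%:Z - 1 = k%:Z by lia.
have [->|ik] := eqVneq i k%:Z.
  rewrite ifT; last by lia.
  by case: ifP; lia.
have [->|ik1] := eqVneq i k.+1%:Z; first by rewrite andbF.
by rewrite !andbT.
Qed.

Lemma stair_top n : stair n n = stair n.-1 0.
Proof. by apply: zindexP => i; rewrite !stairE; case: ifP; case: ifP; lia. Qed.

Lemma index_deg_stair n k : (k < n)%N ->
  index_deg (stair n k) = (index_deg (stair n k.+1)).+1.
Proof.
move=> kn; rewrite -lower_stair //.
have k0 : stair n k (k.+1%:Z - 1) = 0%N by rewrite stairE ifF //; lia.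
have k1 : stair n k k.+1%:Z != 0%N by rewrite stairE ifT //; lia.
have := index_deg_set (set_index (stair n k) k.+1%:Z 0) (k.+1%:Z - 1)
  (stair n k k.+1%:Z).-1.
have := index_deg_set (stair n k) k.+1%:Z 0.
rewrite -/(lower_index _ _) set_indexE k0 if_same; lia.
Qed.

(** * Specialization of SEMs and the SEM of a staircase *)

Section DropStair.
Context (S : dd_algebra).
Local Notation A := (dd_sort S).
Local Notation X := (dd_X S).
Local Notation D := (dd_diff S).
Local Notation e := (dd_esym S).
Local Notation sem := (dd_sem S).

Lemma dd_drop_sem0 a : a 1 != 0%N -> dd_drop S (sem a) = 0.
Proof.
move=> a1; rewrite (@dd_sem_split _ a 1) // rmorphM /= dd_drop_esym /=.
by rewrite dd_esym_gt ?mul0r // lt0n.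
Qed.

Lemma dd_drop_sem a : a 1 = 0%N -> dd_drop S (sem a) = sem (unshift_index a).
Proof.
move=> a1; pose d := [fset (i - 1)%R | i in finsupp a]%fset.
have le : (finsupp (unshift_index a) `<=` d)%fset.
  apply/fsubsetP => i; rewrite mem_finsupp unshift_indexE => ai.
  by apply/imfsetP; exists (i + 1); rewrite ?addrK //= mem_finsupp.
rewrite (dd_semEw S le) /dd_sem rmorph_prod /= big_mkcond [RHS]big_mkcond.
rewrite big_imfset /=; last by move=> x y _ _ /addIr.
rewrite big_seq [RHS]big_seq; apply: eq_bigr => i; rewrite mem_finsupp => ia.
rewrite unshift_indexE subrK dd_drop_esym.
have [i2|i1] := lerP 1 (i - 1).
  rewrite ifT; last by lia.
  by congr (e _ _); lia.
rewrite ifF //; apply/negP => i1'; have ei : i = 1 by lia.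
by rewrite ei a1 in ia.
Qed.

(** SEMs with [a 1 != 0] die and the others are unshifted. An unshifted index may exceed its
    position, in which case its SEM is zero; hence the test in the coefficients. *)
Lemma dd_drop_expands k (f : A) : sem_expands k f ->
  sem_expands (fun a => if `[< admissible a >] then k (shift_index a) else 0)
    (dd_drop S f).
Proof.
move=> [r [ur hr ar ->]].
pose P a := (a 1 == 0%N) && `[< admissible (unshift_index a) >].
exists [seq unshift_index a | a <- r & P a]; split.
- by rewrite map_inj_uniq ?filter_uniq //; apply: can_inj unshift_indexK.
- move=> a; case: asboolP => [adm ka|_]; last by rewrite eqxx.
  apply/mapP; exists (shift_index a); last by rewrite shift_indexK.
  rewrite mem_filter hr // andbT /P shift_indexK shift_indexE subrr.
  by apply/andP; split; [case: adm => a0 _; rewrite a0 | apply/asboolP].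
- by move=> a /mapP [b]; rewrite mem_filter => /andP [/andP [_ /asboolP adm] _] ->.
rewrite linear_sum big_map big_filter [RHS]big_mkcond [LHS]big_seq [RHS]big_seq.
apply: eq_bigr => a /ar [a0 _]; rewrite linearZ /= /P.
case: eqP => [a1|/eqP a1] /=; last by rewrite dd_drop_sem0 // scaler0.
rewrite dd_drop_sem //; case: asboolP => [adm|nadm].
  by rewrite unshift_indexK.
rewrite dd_sem_eq0 ?scaler0 // => i i0; rewrite unshift_indexE.
have [->//|i1] := eqVneq i 0; apply: a0; lia.
Qed.

Lemma dd_sem_nat N a : (forall i, a i != 0%N -> i <= N%:Z) ->
  sem a = \prod_(1 <= i < N.+1) e i (a i%:Z).
Proof.
elim: N a => [|N IH] a aN.
  rewrite big_geq // /dd_sem big_seq_cond big1 // => i /andP [ia i1].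
  by move: ia; rewrite mem_finsupp => /aN; lia.
rewrite big_nat_recr //= (@dd_sem_split _ a N.+1%:Z) // mulrC; congr (_ * _).
rewrite IH => [|i]; last by rewrite set_indexE; case: (i =P N.+1%:Z) => // iN /aN; lia.
apply: eq_big_nat => i /andP [_ iN]; rewrite set_indexE ifF //; lia.
Qed.

Lemma dd_esym_full n : e n n = \prod_(1 <= i < n.+1) X i%:Z.
Proof.
elim: n => [|n IH]; first by rewrite dd_esym0 big_geq.
by rewrite dd_esymS dd_esym_gt // add0r IH mulrC [RHS]big_nat_recr.
Qed.

(** The factor at [i] is the full product [x_1 ... x_i], so the Schubert polynomial of the longest
    permutation of size [n + 1] is a single SEM. *)
Lemma dd_sem_stair n :
  sem (stair n 0) = \prod_(1 <= i < n.+1) X i%:Z ^+ (n.+1 - i).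
Proof.
have -> : sem (stair n 0) = \prod_(1 <= i < n.+1) e i i.
  rewrite (@dd_sem_nat n) => [|i]; last by rewrite stairE; case: ifP => //; lia.
  apply: eq_big_nat => i /andP [i1 iN]; rewrite stairE ifT //; lia.
elim: n => [|n IH]; first by rewrite !big_geq.
rewrite big_nat_recr //= IH dd_esym_full.
rewrite [X in _ * X]big_nat_recr // [RHS]big_nat_recr //= mulrA -big_split /=.
congr (_ * _); last by rewrite subSnn expr1.
by apply: eq_big_nat => i /andP [i1 iN]; rewrite -exprSr -subSn // ltnW.
Qed.

Lemma dd_diff_stair n k : (k < n)%N ->
  D k.+1%:Z (sem (stair n k)) = sem (stair n k.+1).
Proof.
move=> kn; rewrite -lower_stair // dd_diff_sem_lower //.
- exact: admissible_stair.
- by rewrite stairE ifF //; lia.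
- by rewrite stairE ifT //; lia.
Qed.

End DropStair.

(** * Inversions and Coxeter length *)

Implicit Types w u v : int -> int.

Definition bounded_perm w : Prop :=
  injective w /\ exists N : nat, forall i, N%:Z < `|i| -> w i = i.

Lemma in_SZ_bounded w : in_SZ w -> bounded_perm w.
Proof.
move=> [bw /finite_fsetP [F eF]]; split; first exact: bij_inj.
exists (\sum_(i <- F) `|i|)%N => i iN; apply/eqP; apply: contraT => wi.
have iF : i \in F by have : [set` F] i by rewrite -eF.
by move: iN; rewrite (big_fsetD1 i iF) /=; lia.
Qed.

Lemma bounded_comp_refl w i : bounded_perm w -> bounded_perm (w \o simple_refl i).
Proof.
move=> [iw [N wN]]; split.
  by apply: inj_comp => //; apply: inv_inj (simple_reflK i).
exists (N + `|i|%N + 1)%N => j hj /=; rewrite simple_refl_id ?wN //; lia.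
Qed.

Lemma comp_reflK w i : (w \o simple_refl i) \o simple_refl i = w.
Proof. by apply/funext => j /=; rewrite simple_reflK. Qed.

Definition inversions w : set (int * int) :=
  [set p | p.1 < p.2 /\ w p.2 < w p.1].

Definition inv_number w : nat := #|` fset_set (inversions w)|.

Definition int_window (lo : int) (n : nat) : {fset int} :=
  [fset x | x in [seq (lo + j%:Z)%R | j <- iota 0 n]]%fset.

Lemma int_windowE (lo : int) n (i : int) :
  (i \in int_window lo n) = (lo <= i) && (i < lo + n%:Z).
Proof.
apply/imfsetP/idP => [[x /mapP [j]]|/andP [h1 h2]].
  by rewrite mem_iota => hj -> ->; lia.
exists i => //; apply/mapP; exists `|i - lo|%N; last by lia.
by rewrite mem_iota; lia.
Qed.

Definition pair_window (lo : int) (n : nat) : set (int * int) :=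
  [set` int_window lo n] `*` [set` int_window lo n].

Lemma finite_pair_window lo n : finite_set (pair_window lo n).
Proof. by apply: finite_setX; apply: finite_fset. Qed.

(** If [x < lo], then [w y < w x = x] is a fixed point, so [w y = y] by injectivity, against
    [x < y]; the upper end is symmetric. *)
Lemma inversions_sub w (lo : int) n : injective w ->
  (forall i : int, ~~ ((lo <= i) && (i < lo + n%:Z)) -> w i = i) ->
  inversions w `<=` pair_window lo n.
Proof.
move=> iw wid [x y] [/= xy wyx].
have hx : lo <= x /\ y < lo + n%:Z.
  split.
    have [//|xlo] := lerP lo x.
    have wx : w x = x by apply: wid; lia.
    have wy : w (w y) = w y by apply: wid; lia.
    by move/iw: wy => wy; lia.
  have [//|ylo] := ltrP y (lo + n%:Z).
  have wy : w y = y by apply: wid; lia.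
  have wx : w (w x) = w x by apply: wid; lia.
  by move/iw: wx => wx; lia.
by split; rewrite /= int_windowE; lia.
Qed.

Lemma finite_inversions w : bounded_perm w -> finite_set (inversions w).
Proof.
move=> [iw [N wN]].
apply: sub_finite_set (finite_pair_window (- N%:Z) (2 * N + 1)).
apply: inversions_sub => // i hi; apply: wN; lia.
Qed.

(** Exchanging [i] and [i + 1] in both components carries old inversions to new ones, and
    [(i, i + 1)] is the only one added. *)
Lemma inv_number_asc w (i : int) : bounded_perm w -> w i < w (i + 1) ->
  inv_number (w \o simple_refl i) = (inv_number w).+1.
Proof.
move=> bw wi; pose sw (p : int * int) := (simple_refl i p.1, simple_refl i p.2).
have fw := finite_inversions bw.
have swK : involutive sw by move=> [x y]; rewrite /sw /= !simple_reflK.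
have einv : inversions (w \o simple_refl i) = (i, i + 1) |` (sw @` inversions w).
  apply/seteqP; split=> [[x y] [/= xy wxy]|].
    case: (boolP ((x == i) && (y == i + 1))) => [/andP [/eqP -> /eqP ->]|h].
      by left.
    right; exists (sw (x, y)); last exact: swK.
    split=> //=; move: h xy; rewrite /simple_refl; case_ifs; lia.
  move=> p [->|[[x y] [/= xy wyx] <-]].
    by split=> /=; rewrite ?simple_refl1 ?simple_refl2 //; lia.
  split; rewrite /sw /= ?simple_reflK //.
  have h : ~~ ((x == i) && (y == i + 1)).
    by apply/negP => /andP [/eqP ex /eqP ey]; rewrite ex ey in wyx; lia.
  by move: h xy; rewrite /simple_refl; case_ifs; lia.
have fi : finite_set (sw @` inversions w) by apply: finite_image.
rewrite /inv_number einv fset_setU1 // cardfsU1 in_fset_set // fset_set_image //.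
have -> : ((i, i + 1) \in sw @` inversions w) = false.
  apply/negP; rewrite inE => -[[x y] [/= xy _]] [].
  by move: xy; rewrite /simple_refl; case_ifs; lia.
by rewrite card_imfset //=; apply: inv_inj.
Qed.

Lemma inv_number_desc w (i : int) : bounded_perm w -> w (i + 1) < w i ->
  inv_number w = (inv_number (w \o simple_refl i)).+1.
Proof.
move=> bw wi; rewrite -{1}(comp_reflK w i); apply: inv_number_asc.
  exact: bounded_comp_refl.
by rewrite /= simple_refl1 simple_refl2.
Qed.

Lemma perm_asc_or_desc w (i : int) : injective w -> w i < w (i + 1) \/ w (i + 1) < w i.
Proof.
move=> iw; case: (ltrgtP (w i) (w (i + 1))) => [||/iw]; [by left | by right |].
by move/eqP; rewrite (negbTE (neq_succ i)).
Qed.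

(** From a fixed point on the far left, growth by at least one per step gives [i <= w i]; from one
    on the far right, [w i <= i]. *)
Lemma ascending_id w : bounded_perm w -> (forall i, w i < w (i + 1)) -> w = id.
Proof.
move=> [iw [N wN]] asc.
pose lo : int := - N%:Z - 1; pose hi : int := N%:Z + 1.
have wlo : w lo = lo by apply: wN; lia.
have whi : w hi = hi by apply: wN; lia.
have up (n : nat) : lo + n%:Z <= w (lo + n%:Z).
  elim: n => [|n IH]; first by rewrite addr0 wlo.
  have -> : lo + n.+1%:Z = lo + n%:Z + 1 by lia.
  by have := asc (lo + n%:Z); lia.
have down (n : nat) : w (hi - n%:Z) <= hi - n%:Z.
  elim: n => [|n IH]; first by rewrite subr0 whi.
  have := asc (hi - n.+1%:Z).
  have -> : hi - n.+1%:Z + 1 = hi - n%:Z by lia.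
  lia.
apply/funext => i; have [iN|Ni] := ltrP N%:Z `|i|; first exact: wN.
have := up `|i - lo|%N; have := down `|hi - i|%N.
have -> : lo + `|i - lo|%N%:Z = i by lia.
have -> : hi - `|hi - i|%N%:Z = i by lia.
by move=> h1 h2; apply/eqP; rewrite eq_le h1 h2.
Qed.

Lemma inv_number_id : inv_number id = 0%N.
Proof.
rewrite /inv_number; have -> : inversions id = set0; last by rewrite fset_set0.
by apply/seteqP; split=> // -[x y] [/=]; lia.
Qed.

Lemma word_perm_rcons s i : word_perm (rcons s i) = word_perm s \o simple_refl i.
Proof.
by elim: s => [|j s /= ->] //=; apply/funext.
Qed.

Lemma bounded_id : bounded_perm id.
Proof. by split=> //; exists 0%N. Qed.

Lemma bounded_word s : bounded_perm (word_perm s).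
Proof.
elim/last_ind: s => [|s i IH]; first exact: bounded_id.
by rewrite word_perm_rcons; apply: bounded_comp_refl.
Qed.

Lemma inv_number_word s : (inv_number (word_perm s) <= size s)%N.
Proof.
elim/last_ind: s => [|s i IH]; first by rewrite inv_number_id.
have bs := bounded_word s; rewrite word_perm_rcons size_rcons.
case: (perm_asc_or_desc i (proj1 bs)) => h; first by rewrite inv_number_asc.
by have := inv_number_desc bs h; lia.
Qed.

Lemma reduced_word w : bounded_perm w ->
  exists s, w = word_perm s /\ size s = inv_number w.
Proof.
have [n] := ubnP (inv_number w); elim: n w => // n IH w le bw.
have [[i wi]|nd] := EM (exists i, w (i + 1) < w i).
  have e := inv_number_desc bw wi.
  have [||s [es ss]] := IH (w \o simple_refl i); [by lia | exact: bounded_comp_refl |].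
  by exists (rcons s i); rewrite word_perm_rcons -es comp_reflK size_rcons ss e.
have -> : w = id.
  apply: ascending_id => // i; case: (perm_asc_or_desc i (proj1 bw)) => // h.
  by case: nd; exists i.
by exists [::]; rewrite inv_number_id.
Qed.

Lemma coxeter_lengthE w : bounded_perm w -> coxeter_length w = inv_number w.
Proof.
move=> bw; rewrite /coxeter_length; apply: xget_unique.
  by split; [exact: reduced_word | move=> s ->; apply: inv_number_word].
move=> n [[s [ws <-]] h]; have [s' [ws' ss']] := reduced_word bw.
apply/eqP; rewrite eqn_leq -{1}ss' h //= ws; exact: inv_number_word.
Qed.

Lemma shift_permE w i : shift_perm w i = w (i - 1) + 1. Proof. by []. Qed.

Lemma bounded_shift w : bounded_perm w -> bounded_perm (shift_perm w).
Proof.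
move=> [iw [N wN]]; split=> [i j|].
  by rewrite !shift_permE => /addIr /iw /addIr.
by exists N.+1 => i iN; rewrite shift_permE wN ?subrK //; lia.
Qed.

Lemma inv_number_shift w : bounded_perm w ->
  inv_number (shift_perm w) = inv_number w.
Proof.
move=> bw; pose sh (p : int * int) := (p.1 + 1, p.2 + 1).
have e : inversions (shift_perm w) = sh @` inversions w.
  apply/seteqP; split=> [[x y] [/=]|_ [[x y] [/= xy wxy] <-]].
    rewrite !shift_permE => xy wxy; exists (x - 1, y - 1); last by rewrite /sh /= !subrK.
    by split=> /=; lia.
  by rewrite /sh; split=> /=; rewrite ?shift_permE ?addrK; lia.
rewrite /inv_number e fset_set_image; last exact: finite_inversions.
by rewrite card_imfset //= => -[x y] [x' y'] [/addIr -> /addIr ->].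
Qed.

Lemma shift_perm_refl w i :
  shift_perm (w \o simple_refl i) = shift_perm w \o simple_refl (i + 1).
Proof.
apply/funext => j; rewrite /= !shift_permE /=; congr (w _ + 1).
by rewrite /simple_refl; case_ifs; lia.
Qed.

Definition in_Sn (n : nat) u : Prop :=
  injective u /\ forall i, ~~ ((1 <= i) && (i <= n%:Z)) -> u i = i.

Lemma in_Sn_bounded n u : in_Sn n u -> bounded_perm u.
Proof. by move=> [iu uid]; split=> //; exists n => i hi; apply: uid; lia. Qed.

Lemma in_SnW n m u : (n <= m)%N -> in_Sn n u -> in_Sn m u.
Proof. by move=> nm [iu uid]; split=> // i hi; apply: uid; lia. Qed.

Lemma in_Sinf_Sn u : in_Sinf u -> exists n, in_Sn n u.
Proof.
move=> [hu u0]; have [iu [N uN]] := in_SZ_bounded hu; exists N; split=> // i hi.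
by have [/u0 //|i0] := lerP i 0; apply: uN; lia.
Qed.

Lemma in_Sn_window n u (i : int) : in_Sn n u -> 1 <= i -> i <= n%:Z ->
  1 <= u i /\ u i <= n%:Z.
Proof.
move=> [iu uid] i1 iN; case: (boolP ((1 <= u i) && (u i <= n%:Z))) => [/andP //|h].
by have /iu ui := uid _ h; move: h; rewrite ui; lia.
Qed.

(** There is no descent from position [n] on, so that a chain of descents never leaves [S_n]. *)
Lemma in_Sn_desc n u (i : int) : in_Sn n u -> 1 <= i -> u (i + 1) < u i -> i < n%:Z.
Proof.
move=> hu i1 ui; have [//|ni] := ltrP i n%:Z.
have e1 : u (i + 1) = i + 1 by apply: hu.2; lia.
have [ei|ei] : i = n%:Z \/ n%:Z < i by lia.
  by have := in_Sn_window hu i1; lia.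
by have e2 : u i = i; [apply: hu.2; lia | lia].
Qed.

Lemma in_Sn_comp n u (i : int) : in_Sn n u -> 1 <= i -> i < n%:Z ->
  in_Sn n (u \o simple_refl i).
Proof.
move=> [iu uid] i1 iN; split.
  by apply: inj_comp => //; apply: inv_inj (simple_reflK i).
by move=> j hj /=; rewrite simple_refl_id ?uid //; lia.
Qed.

Lemma in_Sn_longest n : in_Sn n (longest_perm n).
Proof.
split=> [i j|i hi]; rewrite /longest_perm; case_ifs; lia.
Qed.

Lemma in_Sn_shift n u : in_Sn n u -> in_Sn n.+1 (shift_perm u).
Proof.
move=> [iu uid]; split=> [i j|i hi]; first by rewrite !shift_permE => /addIr /iu /addIr.
by rewrite shift_permE uid ?subrK //; lia.
Qed.

(** If every position below [n] were a descent, strict decrease inside the window would squeeze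
    [u i] to [n + 1 - i]. *)
Lemma in_Sn_asc n u : in_Sn n u -> u <> longest_perm n ->
  exists2 i : int, 1 <= i < n%:Z & u i < u (i + 1).
Proof.
move=> hu nl; apply: contrapT => na; apply: nl.
have desc (i : int) : 1 <= i -> i < n%:Z -> u (i + 1) < u i.
  move=> i1 iN; case: (perm_asc_or_desc i hu.1) => // h.
  by case: na; exists i => //; rewrite i1.
have lo (k : nat) : k.+1%:Z <= n%:Z -> k%:Z + 1 <= u (n%:Z - k%:Z).
  elim: k => [|k IH] kn; first by have := @in_Sn_window n u n%:Z hu; rewrite subr0; lia.
  have := desc (n%:Z - k.+1%:Z); have -> : n%:Z - k.+1%:Z + 1 = n%:Z - k%:Z by lia.
  lia.
have hi (k : nat) : k.+1%:Z <= n%:Z -> u (k.+1%:Z) <= n%:Z - k%:Z.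
  elim: k => [|k IH] kn; first by have := @in_Sn_window n u 1%N%:Z hu; rewrite subr0; lia.
  have := desc k.+1%:Z; have -> : k.+1%:Z + 1 = k.+2%:Z by lia.
  lia.
apply/funext => i; rewrite /longest_perm; case: ifP => [/andP [i1 iN]|h]; last first.
  by apply: hu.2; rewrite h.
have := lo `|n%:Z - i|%N; have := hi `|i|.-1%N.
have -> : `|i|.-1.+1%:Z = i by lia.
have -> : n%:Z - `|n%:Z - i|%N%:Z = i by lia.
lia.
Qed.

(** Provides the measure [B - inv_number u] for inductions that climb to the longest permutation. *)
Lemma inv_number_bound n : exists B, forall u, in_Sn n u -> (inv_number u <= B)%N.
Proof.
exists #|` fset_set (pair_window 1 n)| => u [iu uid].
have sub : inversions u `<=` pair_window 1 n.
  by apply: inversions_sub => // i hi; apply: uid; lia.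
apply: fsubset_leq_card; rewrite -fset_set_sub //.
  exact: (sub_finite_set sub (finite_pair_window _ _)).
exact: finite_pair_window.
Qed.

(** * Schubert polynomials *)

(* The permutation [n, n-1, ..., n-k+1, n+1, n-k, ..., 1]. *)
Definition stair_perm (n k : nat) : int -> int := fun i =>
  if (1 <= i) && (i <= k%:Z) then n.+1%:Z - i
  else if i == k.+1%:Z then n.+1%:Z
  else if (k.+1%:Z < i) && (i <= n.+1%:Z) then n.+2%:Z - i else i.

Lemma stair_perm0 n : stair_perm n 0 = longest_perm n.+1.
Proof.
by apply/funext => i; rewrite /stair_perm /longest_perm; case_ifs; lia.
Qed.

Lemma stair_perm_top n : stair_perm n n = longest_perm n.
Proof.
by apply/funext => i; rewrite /stair_perm /longest_perm; case_ifs; lia.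
Qed.

Lemma stair_permS n k : (k < n)%N ->
  stair_perm n k \o simple_refl k.+1%:Z = stair_perm n k.+1.
Proof.
move=> kn; apply/funext => i; rewrite /= /simple_refl.
case: (i =P k.+1%:Z) => [->|h1]; first by rewrite /stair_perm; case_ifs; lia.
case: (i =P k.+1%:Z + 1) => [->|h2]; first by rewrite /stair_perm; case_ifs; lia.
by rewrite /stair_perm; case_ifs; lia.
Qed.

Lemma stair_perm_desc n k : (k < n)%N ->
  stair_perm n k (k.+1%:Z + 1) < stair_perm n k k.+1%:Z.
Proof. by move=> kn; rewrite /stair_perm; case_ifs; lia. Qed.

Lemma in_Sn_stair_perm n k : (k <= n)%N -> in_Sn n.+1 (stair_perm n k).
Proof.
elim: k => [_|k IH kn]; first by rewrite stair_perm0; apply: in_Sn_longest.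
by rewrite -stair_permS //; apply: in_Sn_comp; [apply: IH | |]; lia.
Qed.

(** Both quantities drop by one at each of the [n] steps from the staircase of size [n + 1] to that
    of size [n]. *)
Lemma index_deg_longest n :
  index_deg (stair n.-1 0) = inv_number (longest_perm n).
Proof.
elim: n => [|n IH].
  have -> : longest_perm 0 = id.
    by apply/funext => i; rewrite /longest_perm ifF //; lia.
  rewrite inv_number_id /index_deg big1_seq // => i _.
  by rewrite stairE; case: ifP; lia.
have main k : (k <= n)%N -> (index_deg (stair n 0) = index_deg (stair n k) + k)%N /\
    (inv_number (stair_perm n 0) = inv_number (stair_perm n k) + k)%N.
  elim: k => [|k IHk] kn; first by rewrite !addn0.
  have [-> ->] := IHk (ltnW kn); rewrite index_deg_stair //.
  rewrite (inv_number_desc _ (stair_perm_desc kn)) ?stair_permS //.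
    by rewrite !addSnnS.
  exact: in_Sn_bounded (in_Sn_stair_perm (ltnW kn)).
have [-> ] := main n (leqnn n).
by rewrite stair_perm0 stair_perm_top stair_top IH => ->.
Qed.

Section Schubert.
Context (S : dd_algebra).
Local Notation A := (dd_sort S).
Local Notation D := (dd_diff S).
Local Notation sem := (dd_sem S).

(** Fixing the top [n] separates independence of the path ([chain_uniq]) from independence of [n]
    ([chain_succ]); descents replace the comparison of lengths. *)
Inductive chain (n : nat) : (int -> int) -> A -> Prop :=
| chain_top : chain n (longest_perm n) (sem (stair n.-1 0))
| chain_step u i f : 1 <= i -> chain n u f -> u (i + 1) < u i ->
    chain n (u \o simple_refl i) (D i f).

Lemma chain_in_Sn n u f : chain n u f -> in_Sn n u.
Proof.
elim=> [|{}u i {}f i1 _ IH ui]; first exact: in_Sn_longest.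
by apply: in_Sn_comp => //; apply: in_Sn_desc IH i1 ui.
Qed.

Lemma chain_down n u i f : 1 <= i -> u i < u (i + 1) ->
  chain n (u \o simple_refl i) f -> chain n u (D i f).
Proof.
move=> i1 ui ch; rewrite -(comp_reflK u i); apply: chain_step => //=.
by rewrite simple_refl1 simple_refl2.
Qed.

Lemma chain_exists n u : in_Sn n u -> exists f, chain n u f.
Proof.
have [B hB] := inv_number_bound n.
have [m] := ubnP (B - inv_number u)%N; elim: m u => // m IH u le hu.
have [->|nl] := EM (u = longest_perm n); first by eexists; apply: chain_top.
have [i /andP [i1 iN] ui] := in_Sn_asc hu nl.
have hv := in_Sn_comp hu i1 iN.
have e := inv_number_asc (in_Sn_bounded hu) ui.
have [|f ch] := IH _ _ hv; first by have := hB _ hv; lia.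
by exists (D i f); apply: chain_down.
Qed.

Lemma chain_inv n u f : chain n u f ->
  (u = longest_perm n /\ f = sem (stair n.-1 0)) \/
  exists i g, [/\ 1 <= i, i < n%:Z, u i < u (i + 1),
    chain n (u \o simple_refl i) g & f = D i g].
Proof.
case=> [|{}u i {}f i1 ch ui]; [by left | right; exists i, f; split=> //].
- exact: in_Sn_desc (chain_in_Sn ch) i1 ui.
- by rewrite /= simple_refl1 simple_refl2.
- by rewrite comp_reflK.
Qed.

Lemma longest_perm_desc n i : 1 <= i -> i < n%:Z ->
  longest_perm n (i + 1) < longest_perm n i.
Proof. by move=> i1 iN; rewrite /longest_perm; case_ifs; lia. Qed.

(* Diamond lemma: two chains into [u] whose last steps are [i] and [j] are
   compared through a common permutation above [u s_i] and [u s_j]. *)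
Lemma chain_uniq n u f f' : chain n u f -> chain n u f' -> f = f'.
Proof.
have [B hB] := inv_number_bound n.
have [m] := ubnP (B - inv_number u)%N; elim: m u f f' => // m IH u f f' le ch ch'.
have hu := chain_in_Sn ch.
have up i g g' : 1 <= i -> i < n%:Z -> u i < u (i + 1) ->
    chain n (u \o simple_refl i) g -> chain n (u \o simple_refl i) g' -> g = g'.
  move=> i1 iN ui; apply: IH; have hv := in_Sn_comp hu i1 iN.
  by have := inv_number_asc (in_Sn_bounded hu) ui; have := hB _ hv; lia.
have braid i g g' : 1 <= i -> i + 1 < n%:Z -> u i < u (i + 1) ->
    u (i + 1) < u (i + 1 + 1) -> chain n (u \o simple_refl i) g ->
    chain n (u \o simple_refl (i + 1)) g' -> D i g = D (i + 1) g'.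
  move=> i1 iN ui uj chi chj.
  have iN' : i < n%:Z by lia.
  have j1 : 1 <= i + 1 by lia.
  have s1 : simple_refl i (i + 1 + 1) = i + 1 + 1 by apply: simple_refl_id; lia.
  have s2 : simple_refl (i + 1) i = i by apply: simple_refl_id; lia.
  (* With ascents at [i] and [i + 1], both chains can be routed through [u s_i s_(i+1) s_i], and the
     braid relation closes the diamond. *)
  pose v := u \o simple_refl i \o simple_refl (i + 1) \o simple_refl i.
  have [h ch1] : exists h, chain n v h.
    by apply: chain_exists; do 3 (apply: in_Sn_comp => //).
  have ev : v = u \o simple_refl (i + 1) \o simple_refl i \o simple_refl (i + 1).
    apply/funext => k; rewrite /v /=; congr u.
    by rewrite /simple_refl; case_ifs; lia.
  have ch2 := ch1; rewrite ev in ch2.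
  have eg : g = D (i + 1) (D i h).
    apply: up chi _ => //; apply: chain_down => //; last first.
      by apply: chain_down => //; rewrite /= s2 !simple_refl1 s1.
    by rewrite /= simple_refl2 s1; lia.
  have eg' : g' = D i (D (i + 1) h).
    apply: up chj _ => //; apply: chain_down => //; last first.
      by apply: chain_down => //; rewrite /= simple_refl2 s1 s2 simple_refl2.
    by rewrite /= s2 simple_refl1 (lt_trans ui uj).
  by rewrite eg eg' dd_diff_braid.
case: (chain_inv ch) => [[eu ->]|[i [g [i1 iN ui chi ->]]]];
  case: (chain_inv ch') => [[eu' ->]|[j [g' [j1 jN uj chj ->]]]] //.
- by have := longest_perm_desc j1 jN; rewrite -eu; lia.
- by have := longest_perm_desc i1 iN; rewrite -eu'; lia.
have [eij|nij] := eqVneq i j; first by rewrite -eij in chj uj *; rewrite (up i g g').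
have [eij|nij1] := eqVneq j (i + 1).
  by rewrite eij in jN uj chj *; apply: braid.
have [eij|nij2] := eqVneq i (j + 1).
  by apply/ssrfun.esym; rewrite eij in iN ui chi *; apply: braid.
pose v := u \o simple_refl i \o simple_refl j.
have [h ch1] : exists h, chain n v h.
  by apply: chain_exists; do 2 (apply: in_Sn_comp => //).
have ev : v = u \o simple_refl j \o simple_refl i.
  by apply/funext => k; rewrite /v /=; congr u; rewrite /simple_refl; case_ifs; lia.
have ch2 := ch1; rewrite ev in ch2.
have -> : g = D j h.
  by apply: up chi _ => //; apply: chain_down => //=; rewrite !simple_refl_id //; lia.
have -> : g' = D i h.
  by apply: up chj _ => //; apply: chain_down => //=; rewrite !simple_refl_id //; lia.
by apply: dd_diff_comm; lia.
Qed.

(** The longest permutation of size [n + 1] descends through [s_1, ..., s_n] to that of size [n],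
    while the SEMs run through the staircases with moving gap. *)
Lemma chain_succ n u f : chain n u f -> chain n.+1 u f.
Proof.
elim=> [|{}u i {}f i1 _ IH ui]; last exact: chain_step.
have main k : (k <= n)%N -> chain n.+1 (stair_perm n k) (sem (stair n k)).
  elim: k => [_|k IH kn]; first by rewrite stair_perm0; apply: chain_top.
  rewrite -stair_permS // -dd_diff_stair //; apply: chain_step => //.
    exact/IH/ltnW.
  exact: stair_perm_desc.
by have := main n (leqnn n); rewrite stair_perm_top stair_top.
Qed.

Lemma chainW n m u f : (n <= m)%N -> chain n u f -> chain m u f.
Proof.
move=> nm ch; rewrite -(subnK nm); elim: (m - n)%N => // k IH.
by rewrite addSn; apply: chain_succ.
Qed.

Definition dd_schubert u (f : A) : Prop := exists n, chain n u f.

Lemma dd_schubert_uniq u f f' : dd_schubert u f -> dd_schubert u f' -> f = f'.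
Proof.
move=> [n ch] [n' ch']; apply: (@chain_uniq (maxn n n') u).
  exact: chainW (leq_maxl _ _) ch.
exact: chainW (leq_maxr _ _) ch'.
Qed.

Lemma dd_schubert_in_Sn u f : dd_schubert u f -> exists n, in_Sn n u.
Proof. by move=> [n /chain_in_Sn]; exists n. Qed.

Lemma dd_schubert_exists n u : in_Sn n u -> exists f, dd_schubert u f.
Proof. by move=> /chain_exists [f ch]; exists f, n. Qed.

Lemma dd_schubert_desc u i f : 1 <= i -> dd_schubert u f -> u (i + 1) < u i ->
  dd_schubert (u \o simple_refl i) (D i f).
Proof. by move=> i1 [n ch] ui; exists n; apply: chain_step. Qed.

(** At an ascent, [f] is itself [D i] of the polynomial of [u s_i], and [D i] squares to zero. *)
Lemma dd_schubert_asc u i f : 1 <= i -> dd_schubert u f -> u i < u (i + 1) ->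
  D i f = 0.
Proof.
move=> i1 sf ui; have [n hu] := dd_schubert_in_Sn sf.
(* The size is enlarged so that [s_i] acts within the window. *)
have hu' : in_Sn (n + `|i|.+1)%N u by apply: in_SnW hu; lia.
have hv : in_Sn (n + `|i|.+1)%N (u \o simple_refl i) by apply: in_Sn_comp => //; lia.
have [g [m ch]] := dd_schubert_exists hv.
have sg : dd_schubert u (D i g) by exists m; apply: chain_down.
by rewrite (dd_schubert_uniq sf sg) dd_diff_diff.
Qed.

Lemma dd_schubert_expands u f : dd_schubert u f ->
  exists2 k, sem_expands k f & forall a, k a != 0 -> index_deg a = inv_number u.
Proof.
move=> [n ch]; apply: sem_span_expands; elim: ch => [|{}u i {}f i1 ch IH ui].
  rewrite -index_deg_longest; apply: sem_span_sem => //.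
  by case: (admissible_stair n.-1 0).
apply: sem_span_diff => //.
by rewrite -(inv_number_desc (in_Sn_bounded (chain_in_Sn ch)) ui).
Qed.

Lemma dd_schubert_id : dd_schubert id 1.
Proof.
exists 0%N; have {1}<- : longest_perm 0 = id.
  by apply/funext => i; rewrite /longest_perm ifF //; lia.
suff <- : sem (stair 0 0) = 1 by apply: chain_top.
by rewrite dd_sem_stair big_geq.
Qed.

Lemma sem_expands_eq0 k (f : A) : sem_expands k f -> (forall a, k a = 0) -> f = 0.
Proof. by move=> [r [_ _ _ ->]] k0; rewrite big1 // => a _; rewrite k0 scale0r. Qed.

Lemma index_deg_zero a : (forall i, a i = 0%N) -> index_deg a = 0%N.
Proof. by move=> a0; rewrite /index_deg big1. Qed.

(* By induction on the length, the difference of both sides is killed by every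
   divided difference, hence constant; being of positive degree, it is zero. *)
Lemma dd_schubert_drop u f g : dd_schubert u f -> dd_schubert (shift_perm u) g ->
  dd_drop S g = f.
Proof.
have [n] := ubnP (inv_number u); elim: n u f g => // n IH u f g le sf sg.
have [N hu] := dd_schubert_in_Sn sf; have bu := in_Sn_bounded hu.
have [[i ui]|nd] := EM (exists i, u (i + 1) < u i); last first.
  have eu : u = id.
    apply: ascending_id => // i; case: (perm_asc_or_desc i bu.1) => // h.
    by case: nd; exists i.
  have es : shift_perm u = id by rewrite eu; apply/funext => i; rewrite shift_permE subrK.
  rewrite es in sg; rewrite eu in sf.
  rewrite (dd_schubert_uniq sf dd_schubert_id).
  by rewrite (dd_schubert_uniq sg dd_schubert_id) rmorph1.
have upos : (0 < inv_number u)%N by rewrite (inv_number_desc bu ui).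
have killed (j : int) : 1 <= j -> D j (dd_drop S g - f) = 0.
  move=> j1; rewrite linearB /= -dd_drop_diff //.
  have j1' : 1 <= j + 1 by lia.
  have e1 : shift_perm u (j + 1) = u j + 1 by rewrite shift_permE addrK.
  have e2 : shift_perm u (j + 1 + 1) = u (j + 1) + 1 by rewrite shift_permE addrK.
  case: (perm_asc_or_desc j bu.1) => uj.
    rewrite (dd_schubert_asc j1 sf uj) (dd_schubert_asc j1' sg) ?rmorph0 ?subrr //.
    rewrite e1 e2; lia.
  have sf' := dd_schubert_desc j1 sf uj.
  have sg' : dd_schubert (shift_perm (u \o simple_refl j)) (D (j + 1) g).
    by rewrite shift_perm_refl; apply: dd_schubert_desc => //; rewrite e1 e2; lia.
  rewrite (IH _ _ _ _ sf' sg') ?subrr //.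
  by have := inv_number_desc bu uj; lia.
have [k hk kd] := dd_schubert_expands sf; have [k' hk' kd'] := dd_schubert_expands sg.
have hd := sem_expandsB (dd_drop_expands hk') hk.
apply/eqP; rewrite -subr_eq0; apply/eqP; apply: (sem_expands_eq0 hd) => a.
apply/eqP; apply: contraT => ka.
(* Being killed by all divided differences leaves only the zero index, of degree 0, whereas both
   expansions are homogeneous of degree [inv_number u > 0]. *)
have a0 l : a l = 0%N.
  apply: (sem_expands_killed (p := `|l|.+1) hd _ ka); last by lia.
  by move=> j j1 _; apply: killed.
have k0 : k a = 0.
  by apply/eqP; apply: contraT => /kd; rewrite index_deg_zero //; lia.
have k'0 : k' (shift_index a) = 0.
  apply/eqP; apply: contraT => /kd'; rewrite index_deg_zero; last first.
    by move=> l; rewrite shift_indexE.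
  by rewrite inv_number_shift //; lia.
by rewrite k0 k'0 if_same subrr eqxx in ka.
Qed.

Lemma dd_schubert_shift_expands u f g k k' :
  dd_schubert u f -> dd_schubert (shift_perm u) g ->
  sem_expands k f -> sem_expands k' g ->
  forall a, admissible a -> k' (shift_index a) = k a.
Proof.
move=> sf sg hk hk' a adm.
have := dd_drop_expands hk'; rewrite (dd_schubert_drop sf sg) => hd.
by rewrite (sem_expands_uniq hk hd); case: asboolP.
Qed.

End Schubert.

(** * Transfer to the concrete Schubert polynomials and coefficients *)

Lemma fsbig_uniq_seq (V : nmodType) (T : choiceType) (P : set T) (F : T -> V)
    (r : seq T) : uniq r -> (forall t, t \in r -> P t) ->
  (forall t, P t -> F t != 0 -> t \in r) ->
  \sum_(t \in P) F t = \sum_(t <- r) F t.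
Proof.
move=> ur rP Pr; rewrite (fsbigE r) //.
- rewrite big_seq_cond [RHS]big_seq; apply: eq_bigl => t.
  by apply: andb_idr => tr; apply/mem_set/rP.
- move=> t Pt tr; apply/eqP; apply: contraT => /(Pr t Pt) tr'.
  by rewrite tr' in tr.
Qed.

(** Inversion numbers turn the drop of Coxeter length into a descent at [i]. *)
Lemma is_schubert_dd u f : is_schubert u f -> @dd_schubert zpoly_dd u f.
Proof.
elim=> [n|{}u i {}f i1 _ [n ch] lt]; exists n.
  have -> : \prod_(1 <= i < n) Xvar i%:Z ^+ (n - i) = dd_sem zpoly_dd (stair n.-1 0).
    (* For [n = 0] the truncated predecessor gives [stair 0 0], and both sides are empty
       products. *)
    case: n => [|n]; last by rewrite (dd_sem_stair zpoly_dd n).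
    by rewrite (dd_sem_stair zpoly_dd 0) big_geq // big_geq.
  exact: chain_top.
have bu := in_Sn_bounded (chain_in_Sn ch).
rewrite !coxeter_lengthE // in lt; last exact: bounded_comp_refl.
apply: (chain_step i1 ch).
case: (perm_asc_or_desc i bu.1) => // /(inv_number_asc bu); lia.
Qed.

Lemma dd_is_schubert u f : @dd_schubert zpoly_dd u f -> is_schubert u f.
Proof.
move=> [n ch]; elim: ch => [|{}u i {}f i1 ch IH ui].
  have <- : \prod_(1 <= i < n) Xvar i%:Z ^+ (n - i) = dd_sem zpoly_dd (stair n.-1 0).
    case: n => [|n]; last by rewrite (dd_sem_stair zpoly_dd n).
    by rewrite (dd_sem_stair zpoly_dd 0) big_geq // big_geq.
  exact: schubert_longest.
have bu := in_Sn_bounded (chain_in_Sn ch).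
apply: (schubert_step i1 IH).
rewrite !coxeter_lengthE //; last exact: bounded_comp_refl.
by rewrite (inv_number_desc bu ui).
Qed.

(** Existence of a chain ensures that [xget] returns a Schubert polynomial and not its default 0. *)
Lemma schubert_dd n u : in_Sn n u -> @dd_schubert zpoly_dd u (schubert u).
Proof.
move=> /(dd_schubert_exists zpoly_dd) [f hf]; apply: is_schubert_dd.
by apply: (@xgetPex _ 0 [set f | is_schubert u f]); exists f; apply: dd_is_schubert.
Qed.

Lemma sem_expands_expansion k (f : zpoly) :
  @sem_expands zpoly_dd k f -> sem_expansion f k.
Proof.
move=> [r [ur hr ar ef]]; split.
- apply: (sub_finite_set _ (finite_seq r)) => a ka; exact: hr.
- by move=> a na; apply/eqP; apply: contraT => /hr /ar.
rewrite (fsbig_uniq_seq ur) // => a _ ka; apply: hr.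
by apply: contraNneq ka => ->; rewrite scale0r.
Qed.

Lemma sem_expansion_expands k (f : zpoly) :
  sem_expansion f k -> @sem_expands zpoly_dd k f.
Proof.
move=> [fk nk ->]; exists (fset_set [set a | k a != 0]).
have inE' a : (a \in fset_set [set a | k a != 0]) = (k a != 0).
  by rewrite in_fset_set // mem_setE.
have adm a : k a != 0 -> admissible a.
  by move=> ka; apply: contrapT => /nk e0; rewrite e0 eqxx in ka.
split.
- exact: fset_uniq.
- by move=> a; rewrite inE'.
- by move=> a; rewrite inE'; apply: adm.
apply: fsbig_uniq_seq; first exact: fset_uniq.
  by move=> a; rewrite inE'; apply: adm.
by move=> a _ ka; rewrite inE'; apply: contraNneq ka => ->; rewrite scale0r.
Qed.

Lemma kappa_expands n u : in_Sn n u ->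
  @sem_expands zpoly_dd (kappa u) (schubert u).
Proof.
move=> hu; apply: sem_expansion_expands.
have [k hk _] := dd_schubert_expands (schubert_dd hu).
apply: (@xgetPex _ (fun=> 0) [set k | sem_expansion (schubert u) k]).
by exists k; apply: sem_expands_expansion.
Qed.

Lemma kappa_deg n u a : in_Sn n u -> kappa u a != 0 -> index_deg a = inv_number u.
Proof.
move=> hu; have [k hk kd] := dd_schubert_expands (schubert_dd hu).
by rewrite (sem_expands_uniq (kappa_expands hu) hk); apply: kd.
Qed.

Lemma kappa_shift n u a : in_Sn n u -> admissible a ->
  kappa (shift_perm u) (shift_index a) = kappa u a.
Proof.
move=> hu; have hv := in_Sn_shift hu.
exact: (dd_schubert_shift_expands (schubert_dd hu) (schubert_dd hv)
  (kappa_expands hu) (kappa_expands hv)).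
Qed.

(** * Iterated shifts and thresholds *)

Lemma iter_shift_indexE m a i : iter m shift_index a i = a (i - m%:Z).
Proof.
elim: m i => [|m IH] i; first by rewrite subr0.
by rewrite iterS shift_indexE IH; congr (a _); lia.
Qed.

Lemma iter_shift_permE m w i : iter m shift_perm w i = w (i - m%:Z) + m%:Z.
Proof.
elim: m i => [|m IH] i; first by rewrite subr0 addr0.
by rewrite iterS shift_permE IH; have -> : i - 1 - m%:Z = i - m.+1%:Z; lia.
Qed.

Lemma iter_shiftK m : cancel (iter m shift_index) (iter m unshift_index).
Proof. by elim: m => // m IH a; rewrite iterSr iterS shift_indexK IH. Qed.

Lemma iter_unshiftK m : cancel (iter m unshift_index) (iter m shift_index).
Proof. by elim: m => // m IH a; rewrite iterSr iterS unshift_indexK IH. Qed.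

(** The bound [m] is nonnegative, so the convention for the zero index agrees with the vacuous
    condition. Otherwise the seed of the maximum is the value at an index of the support. *)
Lemma thresholdP (m : nat) a :
  threshold a <= m%:Z <-> forall i, a i != 0%N -> (a i)%:Z - i <= m%:Z.
Proof.
rewrite /threshold; case: eqP => [e0|/eqP ne].
  split=> // _ i; rewrite -mem_finsupp e0 in_fset0 //.
set i0 := head 0 (finsupp a).
have i0a : i0 \in finsupp a.
  by rewrite /i0 -nth0 mem_nth // -[size _]/#|` finsupp a| cardfs_gt0.
split=> [le i|h].
  rewrite -mem_finsupp => ia; apply: le_trans le.
  exact: (le_bigmax_seq _ i xpredT (fun i => (a i)%:Z - i)).
have hs i : i \in finsupp a -> (a i)%:Z - i <= m%:Z.
  by rewrite mem_finsupp; apply: h.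
by rewrite big_seq; apply: bigmax_le => [|i]; apply: hs.
Qed.

(** On the support [a i >= 1], so the single inequality [a i <= i + m] also makes the shifted
    position positive. *)
Lemma admissible_iter_shift m a :
  admissible (iter m shift_index a) <-> threshold a <= m%:Z.
Proof.
rewrite thresholdP; split=> [[a0 a1] i ai|h].
  have e : iter m shift_index a (i + m%:Z) = a i by rewrite iter_shift_indexE addrK.
  have [im|im] := lerP (i + m%:Z) 0.
    by have := a0 _ im; rewrite e => e0; rewrite e0 in ai.
  by have := a1 (i + m%:Z); rewrite e; lia.
split=> i hi; rewrite iter_shift_indexE.
  by apply/eqP; apply: contraT => ai; have := h _ ai; lia.
have [-> |ai] := eqVneq (a (i - m%:Z)) 0%N; first by lia.
by have := h _ ai; lia.
Qed.

(** * Truncation of back stable series *)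

Definition supported_above (m : nat) (mu : zmon) : Prop :=
  forall i, mu i != 0%N -> - m%:Z < i.

Lemma supported_mmul m (mu nu : zmon) : supported_above m (mmul mu nu) <->
  supported_above m mu /\ supported_above m nu.
Proof.
split=> [h|[h1 h2] i]; last by rewrite cmM addn_eq0 negb_and => /orP [/h1|/h2].
by split=> i hi; apply: h; rewrite cmM addn_eq0 negb_and hi ?orbT.
Qed.

Lemma supported_above_exists (mu : zmon) : exists m0 : nat,
  forall m, (m0 <= m)%N -> supported_above m mu.
Proof.
exists (\sum_(i <- finsupp mu) `|i|).+1%N => m mm i.
rewrite -mem_finsupp => ia; move: mm; rewrite (big_fsetD1 i ia) /=; lia.
Qed.

(* [f] is the part of [F] in the variables [x_i] with [- m < i]. *)
Definition truncates (m : nat) (F : series) (f : zpoly) : Prop :=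
  forall mu, supported_above m mu -> F mu = f@_mu.

Lemma truncates_one m : truncates m series_one 1.
Proof. by move=> mu _; rewrite mcoeff1. Qed.

Lemma mcoeffM_pairs (K : conomType) (R : comNzRingType) (f g : {malg R[K]}) (k : K) :
  (f * g)@_k = \sum_(p <- [seq p <- [seq (x, y) | x <- msupp f, y <- msupp g]
                          | mmul p.1 p.2 == k]) f@_(p.1) * g@_(p.2).
Proof.
rewrite mcoeffMl big_filter [RHS]big_mkcond [RHS]big_allpairs_dep /=.
by apply: eq_bigr => x _; apply: eq_bigr => y _; case: eqP; rewrite ?mulr1n ?mulr0n.
Qed.

(** Divisors of a monomial supported above [- m] are supported there too, so the coefficient of the
    product only sees the truncated factors, and finitely many pairs contribute. *)
Lemma truncates_mul m F G f g : truncates m F f -> truncates m G g ->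
  truncates m (series_mul F G) (f * g).
Proof.
move=> hF hG mu hmu; rewrite /series_mul mcoeffM_pairs.
set r := [seq p <- _ | _].
have rP p : p \in r -> mmul p.1 p.2 = mu.
  by rewrite mem_filter => /andP [/eqP].
have pP p : mmul p.1 p.2 = mu -> F p.1 = f@_(p.1) /\ G p.2 = g@_(p.2).
  move=> e; rewrite -e in hmu; have [h1 h2] := (supported_mmul m p.1 p.2).1 hmu.
  by split; [apply: hF | apply: hG].
rewrite (@fsbig_uniq_seq _ _ _ _ r).
- rewrite big_seq [RHS]big_seq; apply: eq_bigr => p /rP /pP [-> ->] //.
- apply: filter_uniq; apply: allpairs_uniq; [exact: fset_uniq | exact: fset_uniq |].
  by move=> [x y] [x' y'] _ _ [-> ->].
- by move=> p /rP.
move=> p /= pm; have [-> ->] := pP p pm; rewrite mulf_eq0 negb_or => /andP [fp gp].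
rewrite mem_filter pm eqxx andTb; case: p {pm} fp gp => x y /= fp gp.
by apply: allpairs_f; rewrite -mcoeff_neq0.
Qed.

Definition subset_monom (T : finType) (f : T -> int) (B : {set T}) : zmon :=
  \big[mmul/mone]_(j in B) ucm (f j).

Lemma subset_monomE (T : finType) (f : T -> int) (B : {set T}) j : injective f ->
  subset_monom f B (f j) = (j \in B).
Proof.
move=> fi; rewrite /subset_monom cm_prod.
under eq_bigr => k _ do rewrite cmU (inj_eq fi).
have [jB|jB] := boolP (j \in B).
  rewrite (bigD1 j) //= eqxx big1 // => k /andP [_ /negbTE ->] //.
by rewrite big1 // => k kB; case: eqP => // e; rewrite -e kB in jB.
Qed.

Lemma subset_monom_out (T : finType) (f : T -> int) (B : {set T}) i :
  (forall j, f j != i) -> subset_monom f B i = 0%N.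
Proof.
move=> h; rewrite /subset_monom cm_prod big1 // => k _.
by rewrite cmU (negbTE (h k)).
Qed.

Lemma mdeg_subset_monom (T : finType) (f : T -> int) (B : {set T}) :
  mdeg (subset_monom f B) = #|B|.
Proof.
rewrite /subset_monom mdeg_prod; under eq_bigr => k _ do rewrite mdegU.
by rewrite sum1_card.
Qed.

Lemma relabel_esym sigma n d :
  relabel sigma (esym n d) =
  \sum_(B : {set 'I_n} | #|B| == d)
    << subset_monom (fun j : 'I_n => sigma (j.+1)%:Z) B >>.
Proof.
rewrite relabelE /esym (raddf_sum (subst (Xvar \o sigma))) /=; apply: eq_bigr => B _.
rewrite (rmorph_prod (subst (Xvar \o sigma))) /subset_monom malgU1_prod.
by apply: eq_bigr => j _; apply: substX.
Qed.

(** At most one subset yields [mu], namely the set [B0] of the [j] whose relabelled variable divides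
    [mu]. *)
Lemma relabel_esym_coef sigma n d (mu : zmon) : injective sigma ->
  (relabel sigma (esym n d))@_mu =
  ((mdeg mu == d) && all (fun i => (mu i == 1%N) &&
      [exists j : 'I_n, sigma (j.+1)%:Z == i]) (finsupp mu))%:R.
Proof.
move=> si; set f := fun j : 'I_n => sigma (j.+1)%:Z.
have fi : injective f.
  by move=> j k /si e; apply: val_inj => /=; lia.
rewrite relabel_esym (raddf_sum (mcoeff mu)) /=.
under eq_bigr => B _ do rewrite mcoeffU1.
pose B0 : {set 'I_n} := finset (fun j => mu (f j) != 0%N).
have BB0 B : subset_monom f B = mu -> B = B0.
  move=> e; apply/finset.setP => j; rewrite finset.in_set -e subset_monomE //.
  by case: (j \in B).
have all0 : subset_monom f B0 = mu <->
    all (fun i => (mu i == 1%N) && [exists j : 'I_n, f j == i]) (finsupp mu).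
  split=> [e|/allP h].
    apply/allP => i; rewrite mem_finsupp => hi.
    have [/existsP [j /eqP ej]|/existsPn nj] := boolP [exists j : 'I_n, f j == i].
      rewrite andbT -ej -e subset_monomE //; move: hi.
      by rewrite -ej -{1}e subset_monomE //; case: (j \in B0).
    by move: hi; rewrite -{1}e subset_monom_out ?eqxx.
  apply/eqP/cmP => i.
  have [/existsP [j /eqP ej]|/existsPn nj] := boolP [exists j : 'I_n, f j == i].
    rewrite -ej subset_monomE // finset.in_set; case: eqP => [-> //|/eqP hi].
    by have := h (f j); rewrite mem_finsupp => /(_ hi) /andP [/eqP ->].
  rewrite subset_monom_out //; apply/ssrfun.esym/eqP; apply: contraT => hi.
  have := h i; rewrite mem_finsupp => /(_ hi) /andP [_ /existsP [j /eqP ej]].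
  by have := nj j; rewrite ej eqxx.
have [al|nal] := boolP (all _ _); last first.
  rewrite andbF big1 // => B _; case: eqP => // e.
  by case/negP: nal; apply/all0; rewrite -(BB0 B e).
have e0 := all0.2 al; rewrite andbT -{2}e0 mdeg_subset_monom.
have [eB|nB] := boolP (#|B0| == d).
  rewrite (bigD1 B0) //= e0 eqxx big1 ?addr0 // => B /andP [_ nB].
  by case: eqP => // /BB0 e; rewrite e eqxx in nB.
rewrite big1 // => B /eqP eB; case: eqP => // /BB0 e.
by rewrite -e eB eqxx in nB.
Qed.

Definition shift_down (m : nat) : int -> int := fun i => i - m%:Z.

Lemma shift_down_inj m : injective (shift_down m).
Proof. by move=> i j /addIr. Qed.

(* [e_d] in the variables [x_i], [- m < i <= k] *)
Definition window_esym (m : nat) (k : int) (d : nat) : zpoly :=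
  relabel (shift_down m) (esym (if 0 <= k + m%:Z then absz (k + m%:Z) else 0%N) d).

Lemma window_esym_coef m k d (mu : zmon) : (window_esym m k d)@_mu =
  ((mdeg mu == d) && all (fun i => (mu i == 1%N) &&
      ((- m%:Z < i) && (i <= k))) (finsupp mu))%:R.
Proof.
rewrite /window_esym relabel_esym_coef; last exact: shift_down_inj.
congr (_ && _)%:R; apply: eq_all => i; congr (_ && _).
apply/existsP/idP => [[[j hj] /= /eqP]|/andP [h1 h2]].
  by rewrite /shift_down; move: hj; case: ifP; lia.
have hj : ((absz (i + m%:Z)%R).-1 <
      (if (0 <= k + m%:Z)%R then absz (k + m%:Z)%R else 0))%N.
  by case: ifP; lia.
by exists (Ordinal hj); rewrite /shift_down /=; lia.
Qed.

Lemma truncates_back_esym m k d : truncates m (back_esym k d) (window_esym m k d).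
Proof.
move=> mu hmu; rewrite window_esym_coef /back_esym; congr (_ && _)%:R.
apply: eq_in_all => i; rewrite mem_finsupp => hi.
by rewrite (hmu i hi) andTb andbC.
Qed.

Definition window_sem (m : nat) a : zpoly :=
  \prod_(i <- finsupp a) window_esym m i (a i).

Lemma truncates_back_sem m a : truncates m (back_sem a) (window_sem m a).
Proof.
rewrite /back_sem /window_sem.
elim: (enum_fset (finsupp a)) => [|i r IH].
  by rewrite !big_nil; apply: truncates_one.
by rewrite !big_cons; apply: truncates_mul => //; apply: truncates_back_esym.
Qed.

Lemma window_sem_supported m a (mu : zmon) :
  (window_sem m a)@_mu != 0 -> supported_above m mu.
Proof.
rewrite /window_sem; elim: (enum_fset (finsupp a)) mu => [|i r IH] mu.
  rewrite big_nil mcoeff1; case: (mu =P mone) => [-> _ j|_]; last by rewrite eqxx.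
  by rewrite cm1 eqxx.
rewrite big_cons mcoeff_neq0 => /msuppM_le [k1 [k2 [h1 h2 ->]]].
apply/supported_mmul; split; last by apply: IH; rewrite mcoeff_neq0.
move: h1; rewrite -mcoeff_neq0 window_esym_coef pnatr_eq0 eqb0 negbK.
move=> /andP [_ /allP h] j hj.
by have := h j; rewrite mem_finsupp => /(_ hj) /andP [_ /andP []].
Qed.

(** The threshold puts every shifted support position at 1 or above, so no factor is lost on the
    ordinary side and no window is empty. *)
Lemma window_sem_shift m a : threshold a <= m%:Z ->
  window_sem m a = relabel (shift_down m) (sem (iter m shift_index a)).
Proof.
move=> /thresholdP ta.
pose d := [fset (i + m%:Z)%R | i in finsupp a]%fset.
have le : (finsupp (iter m shift_index a) `<=` d)%fset.
  apply/fsubsetP => i; rewrite mem_finsupp iter_shift_indexE => ai.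
  by apply/imfsetP; exists (i - m%:Z); rewrite ?subrK //= mem_finsupp.
have -> : sem (iter m shift_index a) =
    \prod_(i <- d | 1 <= i) esym `|i|%N (iter m shift_index a i).
  exact: (dd_semEw zpoly_dd le).
rewrite relabelE (rmorph_prod (subst (Xvar \o shift_down m))) big_mkcond.
rewrite big_imfset /=; last by move=> x y _ _ /addIr.
rewrite /window_sem big_seq [RHS]big_seq; apply: eq_bigr => i.
rewrite mem_finsupp => ia; have := ta i ia; move: ia => /eqP ia ti.
rewrite iter_shift_indexE addrK ifT; last by lia.
by rewrite /window_esym ifT //; lia.
Qed.

(** * Back stable expansions *)

Lemma in_Sinf_shift u : in_Sinf u -> in_Sinf (shift_perm u).
Proof.
move=> [[[g ug gu] fu] u0]; split; last first.
  by move=> i i0; rewrite shift_permE u0 ?subrK //; lia.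
split.
  exists (shift_perm g) => i; rewrite !shift_permE addrK.
    by rewrite ug subrK.
  by rewrite gu subrK.
apply: (sub_finite_set _ (finite_image (fun i => i + 1) fu)) => i /= hi.
exists (i - 1); last by rewrite subrK.
by apply: contraNneq hi => e; rewrite shift_permE e subrK.
Qed.

Lemma in_Sinf_iter w m M : (m <= M)%N -> in_Sinf (iter m shift_perm w) ->
  in_Sinf (iter M shift_perm w).
Proof.
move=> mM hm; rewrite -(subnK mM); elim: (M - m)%N => // k IH.
by rewrite addSn iterS; apply: in_Sinf_shift.
Qed.

Lemma kappa_stable w m M a : (m <= M)%N -> in_Sinf (iter m shift_perm w) ->
  threshold a <= m%:Z ->
  kappa (iter M shift_perm w) (iter M shift_index a) =
  kappa (iter m shift_perm w) (iter m shift_index a).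
Proof.
move=> mM hm ta; rewrite -(subnK mM); elim: (M - m)%N => // k IH.
have [n hu] := in_Sinf_Sn (in_Sinf_iter (leq_addl k m) hm).
rewrite addSn !iterS (kappa_shift hu) //.
by apply/admissible_iter_shift; lia.
Qed.

Lemma bounded_iter_shift w M : bounded_perm w ->
  bounded_perm (iter M shift_perm w) /\
  inv_number (iter M shift_perm w) = inv_number w.
Proof.
move=> bw; elim: M => // M [bM iM]; rewrite iterS inv_number_shift //.
by split=> //; apply: bounded_shift.
Qed.

(* Below the support of [w], the polynomial is symmetric, so that the indices
   of its SEM expansion start near [M]; their degree is the length of [w]. *)
Lemma kappa_threshold_bound w m : in_SZ w -> in_Sinf (iter m shift_perm w) ->
  exists M0, forall M a, (m <= M)%N ->
    kappa (iter M shift_perm w) (iter M shift_index a) != 0 ->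
    threshold a <= M0%:Z.
Proof.
move=> hw hm; have bw := in_SZ_bounded hw; have [iw [N wN]] := bw.
(* The degree bounds each entry by [inv_number w], and vanishing below [M - N.+1] keeps the
   unshifted support at or above [- N.+1]. *)
exists (inv_number w + N.+1)%N => M a mM ka.
set u := iter M shift_perm w; set b := iter M shift_index a.
have [n hu] := in_Sinf_Sn (in_Sinf_iter mM hm).
have killed (i : int) : 1 <= i -> i < (M - N.+1)%N%:Z ->
    dd_diff zpoly_dd i (schubert u) = 0.
  move=> i1 iM; apply: (dd_schubert_asc i1 (schubert_dd hu)).
  rewrite /u !iter_shift_permE wN; last by lia.
  by rewrite wN; lia.
have b0 := sem_expands_killed (kappa_expands hu) killed ka.
have db : index_deg b = inv_number w.
  by rewrite (kappa_deg hu ka) (bounded_iter_shift M bw).2.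
have ble i : (b i <= inv_number w)%N.
  have [ib|] := boolP (i \in finsupp b); last by rewrite memNfinsupp => /eqP ->.
  by rewrite -db /index_deg (big_fsetD1 i ib) /=; lia.
apply/thresholdP => i ai.
have bi : b (i + M%:Z) = a i by rewrite /b iter_shift_indexE addrK.
have := ble (i + M%:Z); rewrite bi.
have [lt|] := ltrP (i + M%:Z) (M - N.+1)%N%:Z; last by lia.
by have := b0 _ lt; rewrite -/b bi => e0; rewrite e0 in ai.
Qed.

(** The coefficients are read off at one level [M0] exceeding both [m] and the threshold bound,
    where all indices that ever occur are already admissible. *)
Lemma schubert_back_expansion w m : in_SZ w -> in_Sinf (iter m shift_perm w) ->
  exists (R : seq zindex) (K : zindex -> rat), [/\ uniq R,
    forall a, K a != 0 -> a \in R,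
    forall M a, (m <= M)%N -> threshold a <= M%:Z ->
      kappa (iter M shift_perm w) (iter M shift_index a) = K a &
    forall M, (m <= M)%N -> schubert (iter M shift_perm w) =
      \sum_(a <- R | threshold a <= M%:Z) K a *: sem (iter M shift_index a)].
Proof.
move=> hw hm; have [B hB] := kappa_threshold_bound hw hm.
pose M0 := maxn m B.
have mM0 : (m <= M0)%N by apply: leq_maxl.
pose K a := kappa (iter M0 shift_perm w) (iter M0 shift_index a).
have [n0 hu0] := in_Sinf_Sn (in_Sinf_iter mM0 hm).
have [r [ur hr ar _]] := kappa_expands hu0.
pose R := map (iter M0 unshift_index) r.
have uR : uniq R by rewrite map_inj_uniq //; apply: can_inj (iter_unshiftK M0).
have KR a : K a != 0 -> a \in R.
  by move=> /hr ha; apply/mapP; exists (iter M0 shift_index a) => //; rewrite iter_shiftK.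
have stab M a : (m <= M)%N -> threshold a <= M%:Z ->
    kappa (iter M shift_perm w) (iter M shift_index a) = K a.
  move=> mM ta; case: (leqP M M0) => MM0.
    by rewrite /K (kappa_stable MM0 (in_Sinf_iter mM hm) ta).
  have [t0|t0] := lerP (threshold a) M0%:Z.
    by rewrite /K (kappa_stable (ltnW MM0) (in_Sinf_iter mM0 hm) t0).
  (* An index whose threshold exceeds [M0] has coefficient zero at every level, so it agrees with
     [K] there too. *)
  have z M' : (m <= M')%N -> kappa (iter M' shift_perm w) (iter M' shift_index a) = 0.
    move=> mM'; apply/eqP; apply: contraT => /(hB _ _ mM').
    by rewrite /M0 in t0; lia.
  by rewrite /K !z.
exists R, K; split=> // M mM.
have [n hu] := in_Sinf_Sn (in_Sinf_iter mM hm).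
pose rM := [seq iter M shift_index a | a <- R & threshold a <= M%:Z].
have urM : uniq rM.
  by rewrite map_inj_uniq ?filter_uniq //; apply: can_inj (iter_shiftK M).
have krM b : kappa (iter M shift_perm w) b != 0 -> b \in rM.
  move=> kb; have [rb [_ hrb arb _]] := kappa_expands hu.
  have eb := iter_unshiftK M b; set a := iter M unshift_index b in eb.
  have ta : threshold a <= M%:Z.
    by apply/admissible_iter_shift; rewrite eb; apply: arb; apply: hrb.
  apply/mapP; exists a; last by rewrite eb.
  by rewrite mem_filter ta KR // -(stab M) // eb.
have e := sem_expands_sub urM krM (kappa_expands hu).
apply: etrans e _; rewrite big_map big_filter.
by apply: eq_bigr => a ta; rewrite stab.
Qed.

Lemma relabel_shiftK M f :
  subst (Xvar \o (fun i => i + M%:Z)) (relabel (shift_down M) f) = f.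
Proof.
apply: etrans (relabel_comp _ (shift_down M) f) _.
apply: etrans (eq_subst _ f) (subst_Xvar f) => i /=.
by rewrite /shift_down subrK.
Qed.

Lemma relabel_sum_coef sigma (r : seq zindex) (P : pred zindex)
    (c : zindex -> rat) (F : zindex -> zpoly) (mu : zmon) :
  (relabel sigma (\sum_(a <- r | P a) c a *: F a))@_mu =
  \sum_(a <- r | P a) c a * (relabel sigma (F a))@_mu.
Proof.
rewrite relabelE (raddf_sum (subst (Xvar \o sigma))) (raddf_sum (mcoeff mu)).
apply: eq_bigr => a _.
apply: etrans (congr1 (mcoeff mu) (substZ (Xvar \o sigma) (c a) (F a))) _.
exact: mcoeffZ.
Qed.

Lemma index_threshold_bound (r : seq zindex) :
  exists M : nat, forall a, a \in r -> threshold a <= M%:Z.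
Proof.
elim: r => [|a r [M IH]]; first by exists 0%N.
exists (M + `|threshold a|)%N => b; rewrite inE => /orP [/eqP ->|/IH]; lia.
Qed.

(** For a fixed [mu], once [M] passes [m], the thresholds of [R] and the support of [mu], the
    coefficient is that of the back stable sum; any eventual value agrees with it at a common later
    [M]. *)
Lemma back_schubertE w m (R : seq zindex) (K : zindex -> rat) :
  in_Sinf (iter m shift_perm w) ->
  (forall M, (m <= M)%N -> schubert (iter M shift_perm w) =
      \sum_(a <- R | threshold a <= M%:Z) K a *: sem (iter M shift_index a)) ->
  forall mu, back_schubert w mu = \sum_(a <- R) K a * back_sem a mu.
Proof.
move=> hm hS mu; have [B hB] := index_threshold_bound R.
have [m0 hm0] := supported_above_exists mu.
have coef M : (maxn m (maxn B m0) <= M)%N ->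
    (relabel (shift_down M) (schubert (iter M shift_perm w)))@_mu =
    \sum_(a <- R) K a * back_sem a mu.
  rewrite !geq_max => /andP [mM /andP [BM m0M]].
  rewrite (hS M mM) relabel_sum_coef.
  have tR a : a \in R -> threshold a <= M%:Z by move=> /hB; lia.
  rewrite big_seq_cond [RHS]big_seq; apply: eq_big => [a|a /andP [_ ta]].
    by apply: andb_idr => /tR.
  by rewrite -(window_sem_shift ta) (truncates_back_sem a (hm0 M m0M)).
rewrite /back_schubert; apply: xget_unique.
  by exists (maxn m (maxn B m0)) => M hM _; apply: coef.
move=> c [N hN]; pose M := maxn N (maxn m (maxn B m0)).
have mM : (m <= M)%N by rewrite /M; lia.
rewrite -(coef M); last by rewrite /M leq_maxr.
by apply/ssrfun.esym/hN; [rewrite /M leq_maxl | apply: in_Sinf_iter hm].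
Qed.

(** Truncating and shifting by a large [M] turns a relation into one between ordinary SEMs with
    distinct admissible indices. *)
Lemma back_sem_indep (r : seq zindex) (c : zindex -> rat) : uniq r ->
  (forall mu, \sum_(a <- r) c a * back_sem a mu = 0) ->
  forall a, a \in r -> c a = 0.
Proof.
move=> ur sum0; have [M hM] := index_threshold_bound r.
apply: (@sem_indep_admissible zpoly_dd _ r (iter M shift_index) c).
- by rewrite map_inj_uniq //; apply: can_inj (iter_shiftK M).
- by move=> a /hM ta; apply/admissible_iter_shift.
pose P := \sum_(a <- r) c a *: sem (iter M shift_index a).
suff P0 : P = 0 by exact: P0.
have e : relabel (shift_down M) P = 0.
  apply/malgP => mu; rewrite mcoeff0 /P relabel_sum_coef.
  (* Above [- M] the coefficients come from the given relation; the other monomials do not occur in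
     the truncated SEMs. *)
  have [hmu|hmu] := EM (supported_above M mu).
    apply: etrans (sum0 mu); rewrite big_seq [RHS]big_seq; apply: eq_bigr => a ar.
    by rewrite -(window_sem_shift (hM a ar)) (truncates_back_sem a hmu).
  rewrite big_seq big1 // => a ar; rewrite -(window_sem_shift (hM a ar)).
  have -> : (window_sem M a)@_mu = 0; last by rewrite mulr0.
  by apply/eqP; apply: contraT => /window_sem_supported.
apply: etrans (ssrfun.esym (relabel_shiftK M P)) _; rewrite e.
exact: (raddf0 (subst (Xvar \o (fun i => i + M%:Z)))).
Qed.

(** Two finite expansions of the same series are compared over a common list, so independence
    identifies the one chosen by [xget] with [K]. *)
Lemma back_kappa_unique w (R : seq zindex) (K : zindex -> rat) : uniq R ->
  (forall a, K a != 0 -> a \in R) ->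
  (forall mu, back_schubert w mu = \sum_(a <- R) K a * back_sem a mu) ->
  back_kappa w = K.
Proof.
move=> uR KR bE; rewrite /back_kappa.
have expand (r : seq zindex) (k : zindex -> rat) mu : uniq r ->
    (forall a, k a != 0 -> a \in r) ->
    \sum_(a \in [set: zindex]) k a * back_sem a mu = \sum_(a <- r) k a * back_sem a mu.
  move=> ur kr; apply: fsbig_uniq_seq => // a _.
  by rewrite mulf_eq0 negb_or => /andP [/kr].
apply: xget_unique => [|k [fk hk]].
  split; first by apply: (sub_finite_set _ (finite_seq R)) => a; apply: KR.
  by move=> mu; rewrite (expand R).
pose r := undup (R ++ fset_set [set a | k a != 0]).
have ur : uniq r by apply: undup_uniq.
have kr a : k a != 0 -> a \in r.
  move=> ka; rewrite mem_undup mem_cat; apply/orP; right.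
  by rewrite in_fset_set //; apply/mem_set.
have Kr a : K a != 0 -> a \in r by move=> /KR aR; rewrite mem_undup mem_cat aR.
have sum0 mu : \sum_(a <- r) (k a - K a) * back_sem a mu = 0.
  under eq_bigr do rewrite mulrBl.
  by rewrite sumrB -(expand r k) // -(expand r K) // -hk (expand R) // -bE subrr.
have z := back_sem_indep ur sum0.
apply/funext => a; have [/z /eqP|ar] := boolP (a \in r).
  by rewrite subr_eq0 => /eqP.
have [-> |/kr h] := eqVneq (k a) 0; last by rewrite h in ar.
by have [-> //|/Kr h] := eqVneq (K a) 0; rewrite h in ar.
Qed.

Theorem theorem3p7 (w : int -> int) (hw : in_SZ w) (m : nat)
    (hm : in_Sinf (iter m shift_perm w)) :
  schubert (iter m shift_perm w) =
    \sum_(a \in [set a : zindex | threshold a <= m%:Z])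
      back_kappa w a *: sem (iter m shift_index a)
  /\
  (forall a : zindex, threshold a <= m%:Z ->
     kappa (iter m shift_perm w) (iter m shift_index a) = back_kappa w a).
Proof.
have [R [K [uR KR stab hS]]] := schubert_back_expansion hw hm.
have -> : back_kappa w = K.
  by apply: (back_kappa_unique uR KR); apply: back_schubertE hm hS.
split; last by move=> a; apply: stab.
rewrite (@fsbig_uniq_seq _ _ _ _ [seq a <- R | threshold a <= m%:Z]).
- by rewrite big_filter; apply: hS.
- exact: filter_uniq.
- by move=> a; rewrite mem_filter => /andP [].
move=> a ta ka; rewrite mem_filter KR ?andbT //.
by apply: contraNneq ka => ->; rewrite scale0r.
Qed.
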